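(* Let $n$ be a positive integer and let $M$ be an irreducible Harish-Chandra $\mathfrak{s}_n$-module on which $z$ acts as zero. Then $\mathfrak{h}_nM=0$, i.e., $M$ is an irreducible $\mathfrak{so}_n\oplus\mathfrak{sl}_2$-module. Hence $M\cong V\otimes L$ for some finite dimensional irreducible $\mathfrak{so}_n$-module $V$ and some irreducible weight $\mathfrak{sl}_2$-module $L$.
   Context: For a positive integer $n$, the Schrödinger Lie algebra $\mathfrak{s}_n=(\mathfrak{sl}_2\oplus\mathfrak{so}_n)\ltimes\mathfrak{h}_n$ is the complex Lie algebra with basis $e,f,h$ (spanning $\mathfrak{sl}_2$), $s_{ij}$ for $1\leq i<j\leq n$ (spanning $\mathfrak{so}_n$, the skew-symmetric $n\times n$ matrices, with $s_{ij}$ corresponding to $e_{ij}-e_{ji}$), and $x_1,\dots,x_n,y_1,\dots,y_n,z$ (spanning the Heisenberg algebra $\mathfrak{h}_n$). Put $s_{ji}=-s_{ij}$, $s_{ii}=0$. The non-trivial brackets are $$[h,e]=2e,\ [h,f]=-2f,\ [e,f]=h,\quad [x_i,y_i]=z,\ [h,x_i]=x_i,\ [h,y_i]=-y_i,\quad [e,y_i]=x_i,\ [f,x_i]=y_i,$$ $$[s_{kl},x_i]=\delta_{li}x_k-\delta_{ki}x_l,\quad [s_{kl},y_i]=\delta_{li}y_k-\delta_{ki}y_l,$$ $$[s_{ij},s_{kl}]=\delta_{kj}s_{il}+\delta_{il}s_{jk}+\delta_{lj}s_{ki}+\delta_{ki}s_{lj};$$ all other brackets between basis elements of different types, and $[x_i,x_j]$,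 $[y_i,y_j]$, $[x_i,y_j]$ for $i\ne j$, vanish; $z$ is central. For $n=1$, $\mathfrak{so}_1=0$, and an irreducible $\mathfrak{so}_1$-module is a one-dimensional space. An $\mathfrak{s}_n$-module (or $\mathfrak{sl}_2$-module) $M$ is a weight module if $h$ acts diagonally, i.e. $M=\bigoplus_{\lambda\in\mathbb{C}}M_\lambda$ with $M_\lambda=\{v\in M\mid hv=\lambda v\}$. A weight module is a Harish-Chandra module if all weight spaces $M_\lambda$ are finite dimensional. In $V\otimes L$, $\mathfrak{so}_n$ acts on the first factor, $\mathfrak{sl}_2$ on the second, and $\mathfrak{h}_n$ by zero. *)

(* Defs.v *)
From HB Require Import structures.
From mathcomp Require Import all_boot all_order all_algebra ring.
From mathcomp Require Import complex reals.

Set Implicit Arguments.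
Unset Strict Implicit.
Unset Printing Implicit Defensive.

Import GRing.Theory.
Local Open Scope ring_scope.

HB.mixin Record isLieAlgebra (K : fieldType) L of GRing.Lmodule K L := {
  lie : L -> L -> L;
  lie_linearl : forall y, linear (lie^~ y);
  lie_linearr : forall x, linear (lie x);
  liexx : forall x, lie x x = 0;
  lie_jacobi : forall x y z,
    lie x (lie y z) + lie y (lie z x) + lie z (lie x y) = 0
}.

#[short(type="lieAlgType")]
HB.structure Definition LieAlgebra (K : fieldType) :=
  {L of GRing.Lmodule K L & isLieAlgebra K L}.

Section LinearFacts.
Variables (K : fieldType) (U V : lmodType K) (f : U -> V).
Hypothesis f_lin : linear f.

Lemma linear_mapD x y : f (x + y) = f x + f y.
Proof. by have := f_lin 1 x y; rewrite !scale1r. Qed.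

Lemma linear_map0 : f 0 = 0.
Proof. by have := f_lin (-1) 0 0; rewrite !scaleN1r !addNr. Qed.

Lemma linear_mapN x : f (- x) = - f x.
Proof. by have := f_lin (-1) x 0; rewrite !scaleN1r linear_map0 !addr0. Qed.

Lemma linear_mapZ a x : f (a *: x) = a *: f x.
Proof. by have := f_lin a x 0; rewrite linear_map0 !addr0. Qed.

Lemma linear_map_sum I (r : seq I) (P : pred I) (F : I -> U) :
  f (\sum_(i <- r | P i) F i) = \sum_(i <- r | P i) f (F i).
Proof. exact: (big_morph _ linear_mapD linear_map0). Qed.

End LinearFacts.

Section LieTheory.
Variables (K : fieldType) (L : lieAlgType K).
Implicit Types x y z : L.

Lemma lieC x y : lie x y = - lie y x.
Proof.
apply/eqP; rewrite -addr_eq0; apply/eqP; have := liexx (x + y).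
rewrite (linear_mapD (lie_linearl _)) !(linear_mapD (lie_linearr _)) !liexx.
by rewrite add0r addr0.
Qed.

End LieTheory.

Section DirectSum.
Variables (K : fieldType) (L1 L2 : lieAlgType K).

Definition prod_lie (x y : L1 * L2) : L1 * L2 := (lie x.1 y.1, lie x.2 y.2).

Fact prod_lie_linearl y : linear (prod_lie^~ y).
Proof. by move=> a u v; rewrite /prod_lie /= !lie_linearl. Qed.

Fact prod_lie_linearr x : linear (prod_lie x).
Proof. by move=> a u v; rewrite /prod_lie /= !lie_linearr. Qed.

Fact prod_liexx x : prod_lie x x = 0.
Proof. by rewrite /prod_lie !liexx. Qed.

Fact prod_lie_jacobi x y z :
  prod_lie x (prod_lie y z) + prod_lie y (prod_lie z x)
  + prod_lie z (prod_lie x y) = 0.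
Proof.
by apply/eqP; rewrite xpair_eqE /=; apply/andP; split; apply/eqP;
  exact: lie_jacobi.
Qed.

HB.instance Definition _ := isLieAlgebra.Build K (L1 * L2)%type
  prod_lie_linearl prod_lie_linearr prod_liexx prod_lie_jacobi.

End DirectSum.

Section Commutator.
Variables (K : fieldType) (m : nat).
Implicit Types A B C : 'M[K]_m.

Definition mxcomm A B : 'M[K]_m := A *m B - B *m A.

Lemma mxcomm_linearl B : linear (mxcomm^~ B).
Proof.
move=> a A A'; rewrite /mxcomm mulmxDl mulmxDr -scalemxAl -scalemxAr.
by rewrite scalerBr opprD addrACA.
Qed.

Lemma mxcomm_linearr A : linear (mxcomm A).
Proof.
move=> a B B'; rewrite /mxcomm mulmxDl mulmxDr -scalemxAl -scalemxAr.
by rewrite scalerBr opprD addrACA.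
Qed.

Lemma mxcommxx A : mxcomm A A = 0.
Proof. by rewrite /mxcomm subrr. Qed.

Lemma mxcomm_jacobi A B C :
  mxcomm A (mxcomm B C) + mxcomm B (mxcomm C A) + mxcomm C (mxcomm A B) = 0.
Proof.
rewrite /mxcomm !mulmxBl !mulmxBr !mulmxA; apply/matrixP=> i j; rewrite !mxE.
ring.
Qed.

End Commutator.

Section Sl2.
Variable K : fieldType.

Definition traceless2 : {pred 'M[K]_2} := [pred A | \tr A == 0].

Fact traceless2_submod : submod_closed traceless2.
Proof.
split=> [|a A B /eqP trA /eqP trB]; rewrite inE ?mxtrace0 //.
by rewrite mxtraceD mxtraceZ trA trB mulr0 addr0.
Qed.

HB.instance Definition _ :=
  GRing.isSubmodClosed.Build K 'M[K]_2 traceless2 traceless2_submod.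

Record sl2 := Sl2 {sl2_mx :> 'M[K]_2; sl2P : sl2_mx \in traceless2}.

HB.instance Definition _ := [isSub for sl2_mx].
HB.instance Definition _ := [Choice of sl2 by <:].
HB.instance Definition _ := [SubChoice_isSubLmodule of sl2 by <:].

Fact sl2_lie_subproof (A B : sl2) : mxcomm A B \in traceless2.
Proof. by rewrite inE /mxcomm mxtraceD linearN /= mxtrace_mulC subrr. Qed.

Definition sl2_lie (A B : sl2) : sl2 := Sl2 (sl2_lie_subproof A B).

Fact sl2_lie_linearl B : linear (sl2_lie^~ B).
Proof. by move=> a A A'; apply: val_inj; exact: mxcomm_linearl. Qed.

Fact sl2_lie_linearr A : linear (sl2_lie A).
Proof. by move=> a B B'; apply: val_inj; exact: mxcomm_linearr. Qed.

Fact sl2_liexx A : sl2_lie A A = 0.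
Proof. by apply: val_inj; exact: mxcommxx. Qed.

Fact sl2_lie_jacobi A B C :
  sl2_lie A (sl2_lie B C) + sl2_lie B (sl2_lie C A)
  + sl2_lie C (sl2_lie A B) = 0.
Proof. by apply: val_inj; exact: mxcomm_jacobi. Qed.

HB.instance Definition _ := isLieAlgebra.Build K sl2
  sl2_lie_linearl sl2_lie_linearr sl2_liexx sl2_lie_jacobi.

Fact sl2_e_subproof : delta_mx 0 1 \in traceless2.
Proof. by rewrite inE /mxtrace !big_ord_recl big_ord0 !mxE /= !addr0. Qed.

Fact sl2_f_subproof : delta_mx 1 0 \in traceless2.
Proof. by rewrite inE /mxtrace !big_ord_recl big_ord0 !mxE /= !addr0. Qed.

Fact sl2_h_subproof : delta_mx 0 0 - delta_mx 1 1 \in traceless2.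
Proof.
rewrite inE /mxtrace !big_ord_recl big_ord0 !mxE /=.
by rewrite !(addr0, subr0, add0r) subrr.
Qed.

Definition sl2_e : sl2 := Sl2 sl2_e_subproof.
Definition sl2_f : sl2 := Sl2 sl2_f_subproof.
Definition sl2_h : sl2 := Sl2 sl2_h_subproof.

End Sl2.

Section So.
Variables (K : fieldType) (n : nat).

Definition skew_mx : {pred 'M[K]_n} := [pred A | A^T == - A].

Fact skew_mx_submod : submod_closed skew_mx.
Proof.
split=> [|a A B /eqP sA /eqP sB]; rewrite inE; first by rewrite trmx0 oppr0.
by rewrite linearP /= sA sB scalerN opprD.
Qed.

HB.instance Definition _ :=
  GRing.isSubmodClosed.Build K 'M[K]_n skew_mx skew_mx_submod.

Record so := So {so_mx :> 'M[K]_n; soP : so_mx \in skew_mx}.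

HB.instance Definition _ := [isSub for so_mx].
HB.instance Definition _ := [Choice of so by <:].
HB.instance Definition _ := [SubChoice_isSubLmodule of so by <:].

Fact so_lie_subproof (A B : so) : mxcomm A B \in skew_mx.
Proof.
rewrite inE /mxcomm linearB /= !trmx_mul.
rewrite (eqP (soP A)) (eqP (soP B)).
by rewrite !mulmxN !mulNmx !opprK opprB.
Qed.

Definition so_lie (A B : so) : so := So (so_lie_subproof A B).

Fact so_lie_linearl B : linear (so_lie^~ B).
Proof. by move=> a A A'; apply: val_inj; exact: mxcomm_linearl. Qed.

Fact so_lie_linearr A : linear (so_lie A).
Proof. by move=> a B B'; apply: val_inj; exact: mxcomm_linearr. Qed.

Fact so_liexx A : so_lie A A = 0.
Proof. by apply: val_inj; exact: mxcommxx. Qed.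

Fact so_lie_jacobi A B C :
  so_lie A (so_lie B C) + so_lie B (so_lie C A) + so_lie C (so_lie A B) = 0.
Proof. by apply: val_inj; exact: mxcomm_jacobi. Qed.

HB.instance Definition _ := isLieAlgebra.Build K so
  so_lie_linearl so_lie_linearr so_liexx so_lie_jacobi.

Fact so_s_subproof (i j : 'I_n) : delta_mx i j - delta_mx j i \in skew_mx.
Proof. by rewrite inE linearB /= !trmx_delta opprB. Qed.

Definition so_s (i j : 'I_n) : so := So (so_s_subproof i j).

End So.

(* A triple (a, b, c) stands for \sum_i a_i x_i + \sum_i b_i y_i + c z. *)
Section Heisenberg.
Variables (K : fieldType) (n : nat).

Definition heis : Type := ('cV[K]_n * 'cV[K]_n * K^o)%type.
HB.instance Definition _ := GRing.Lmodule.on heis.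

Implicit Types u v w : heis.

Definition dotc (a b : 'cV[K]_n) : K := \sum_i a i 0 * b i 0.

Definition heis_lie u v : heis :=
  (0, 0, dotc u.1.1 v.1.2 - dotc u.1.2 v.1.1).

Lemma dotcDl a a' b : dotc (a + a') b = dotc a b + dotc a' b.
Proof. by rewrite -big_split; apply: eq_bigr => i _; rewrite mxE mulrDl. Qed.

Lemma dotcC a b : dotc a b = dotc b a.
Proof. by apply: eq_bigr => i _; rewrite mulrC. Qed.

Lemma dotcDr a b b' : dotc a (b + b') = dotc a b + dotc a b'.
Proof. by rewrite dotcC dotcDl !(dotcC a). Qed.

Lemma dotcZl k a b : dotc (k *: a) b = k * dotc a b.
Proof. by rewrite mulr_sumr; apply: eq_bigr => i _; rewrite mxE mulrA. Qed.

Lemma dotcZr k a b : dotc a (k *: b) = k * dotc a b.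
Proof. by rewrite dotcC dotcZl dotcC. Qed.

Lemma dotc_skew (A : so K n) a b : dotc (A *m a) b = - dotc a (A *m b).
Proof.
have dotcE c d : dotc c d = (c^T *m d) 0 0.
  by rewrite mxE; apply: eq_bigr => i _; rewrite mxE.
by rewrite !dotcE trmx_mul (eqP (soP A)) mulmxN mulNmx -mulmxA mxE.
Qed.

Lemma heis_eq u v :
  u.1.1 = v.1.1 -> u.1.2 = v.1.2 -> u.2 = v.2 -> u = v.
Proof. by case: u v => [[a b] c] [[a' b'] c'] /= -> -> ->. Qed.

Fact heis_lie_linearl v : linear (heis_lie^~ v).
Proof.
move=> a u u'; apply: heis_eq; rewrite /= ?scaler0 ?addr0 //.
by rewrite !dotcDl !dotcZl /GRing.scale /=; ring.
Qed.

Fact heis_lie_linearr u : linear (heis_lie u).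
Proof.
move=> a v v'; apply: heis_eq; rewrite /= ?scaler0 ?addr0 //.
by rewrite !dotcDr !dotcZr /GRing.scale /=; ring.
Qed.

Fact heis_liexx u : heis_lie u u = 0.
Proof. by apply: heis_eq; rewrite //= dotcC subrr. Qed.

Lemma dotc0 a : dotc a 0 = 0.
Proof. by rewrite -(scale0r 0) dotcZr mul0r. Qed.

Fact heis_lie_jacobi u v w :
  heis_lie u (heis_lie v w) + heis_lie v (heis_lie w u)
  + heis_lie w (heis_lie u v) = 0.
Proof. by apply: heis_eq; rewrite /= ?dotc0 ?subrr ?addr0. Qed.

HB.instance Definition _ := isLieAlgebra.Build K heis
  heis_lie_linearl heis_lie_linearr heis_liexx heis_lie_jacobi.

Definition heis_x (i : 'I_n) : heis := (delta_mx i 0, 0, 0).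
Definition heis_y (i : 'I_n) : heis := (0, delta_mx i 0, 0).
Definition heis_z : heis := (0, 0, 1).

(* sl_2 acts on the n planes spanned by (x_i, y_i) as on column vectors, so_n
   acts on the x_i and on the y_i as on the standard basis of K^n, and z is
   killed. *)
Definition levi_act (g : sl2 K * so K n) u : heis :=
  let S := sl2_mx g.1 in let A := so_mx g.2 in
  (S 0 0 *: u.1.1 + S 0 1 *: u.1.2 + A *m u.1.1,
   S 1 0 *: u.1.1 + S 1 1 *: u.1.2 + A *m u.1.2,
   0).

Lemma levi_act_linearl u : linear (levi_act^~ u).
Proof.
move=> a g g'; apply: heis_eq; rewrite /= ?scaler0 ?addr0 //.
all: rewrite !mxE !mulmxDl -!scalemxAl !scalerDl !scalerDr !scalerA.
all: by apply/matrixP=> i j; rewrite !mxE; ring.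
Qed.

Lemma levi_act_linearr g : linear (levi_act g).
Proof.
move=> a u v; apply: heis_eq; rewrite /= ?scaler0 ?addr0 //.
all: rewrite !mulmxDr -!scalemxAr.
all: by apply/matrixP=> i j; rewrite !mxE; ring.
Qed.

Lemma levi_act_lie g g' u :
  levi_act (lie g g') u = levi_act g (levi_act g' u) - levi_act g' (levi_act g u).
Proof.
apply: heis_eq; rewrite /= ?subrr //.
all: rewrite !mxE !big_ord_recl !big_ord0 !addr0 /mxcomm.
all: rewrite !mulmxDr !mulmxBl !mulmxA -!scalemxAr.
all: rewrite (_ : lift ord0 ord0 = 1); last exact: val_inj.
all: by apply/matrixP=> i j; rewrite !mxE; ring.
Qed.

Lemma levi_act_der g u v :
  levi_act g (lie u v) = lie (levi_act g u) v + lie u (levi_act g v).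
Proof.
apply: heis_eq; rewrite /= ?scaler0 ?mulmx0 ?addr0 //.
case: g => [S A] /=.
have trS : sl2_mx S 1 1 = - sl2_mx S 0 0.
  have := sl2P S; rewrite inE /mxtrace !big_ord_recl big_ord0 addr0.
  rewrite (_ : lift ord0 ord0 = 1); last exact: val_inj.
  by rewrite addr_eq0 => /eqP ->; rewrite opprK.
rewrite !dotcDl !dotcDr !dotcZl !dotcZr !dotc_skew trS; ring.
Qed.

End Heisenberg.

(* The semidirect product (sl_2 + so_n) |x h_n. *)
Section Schrodinger.
Variables (K : fieldType) (n : nat).

Definition schrodinger : Type := ((sl2 K * so K n) * heis K n)%type.
HB.instance Definition _ := GRing.Lmodule.on schrodinger.

Implicit Types p q r : schrodinger.

Definition schrodinger_lie p q : schrodinger :=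
  (lie p.1 q.1, levi_act p.1 q.2 - levi_act q.1 p.2 + lie p.2 q.2).

Fact schrodinger_lie_linearl q : linear (schrodinger_lie^~ q).
Proof.
move=> a p p'; apply/eqP; rewrite xpair_eqE /= lie_linearl eqxx /=.
rewrite lie_linearl levi_act_linearl levi_act_linearr; apply/eqP.
move: (levi_act p.1 _) (levi_act p'.1 _) (levi_act q.1 _) (levi_act q.1 _).
move: (lie p.2 _) (lie p'.2 _) => u u' v v' w w'.
by apply: heis_eq; last (rewrite /= /GRing.scale /=; ring);
  apply/matrixP=> i j; rewrite !mxE; ring.
Qed.

Fact schrodinger_liexx p : schrodinger_lie p p = 0.
Proof. by rewrite /schrodinger_lie !liexx subrr addr0. Qed.

Fact schrodinger_lieC p q : schrodinger_lie p q = - schrodinger_lie q p.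
Proof.
apply/eqP; rewrite xpair_eqE /= (lieC p.1) eqxx /= (lieC p.2).
by rewrite opprD opprB.
Qed.

Fact schrodinger_lie_linearr p : linear (schrodinger_lie p).
Proof.
move=> a q q'; rewrite schrodinger_lieC schrodinger_lie_linearl.
by rewrite opprD -scalerN -!(schrodinger_lieC p).
Qed.

Fact schrodinger_lie_jacobi p q r :
  schrodinger_lie p (schrodinger_lie q r)
  + schrodinger_lie q (schrodinger_lie r p)
  + schrodinger_lie r (schrodinger_lie p q) = 0.
Proof.
apply/eqP; rewrite xpair_eqE /= lie_jacobi eqxx /=; apply/eqP.
case: p q r => [g u] [g' v] [g'' w] /=.
rewrite !(linear_mapD (levi_act_linearr _)) !(linear_mapN (levi_act_linearr _)).
rewrite !levi_act_lie !levi_act_der.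
rewrite !(linear_mapD (lie_linearr _)) !(linear_mapN (lie_linearr _)).
rewrite !(lieC (levi_act _ _)).
rewrite -[RHS](lie_jacobi u v w).
move: (lie u (lie _ _)) (lie v (lie _ _)) (lie w (lie _ _)) => a1 a2 a3.
move: (levi_act g (levi_act g' w)) (levi_act g (levi_act g'' v)) => b1 b2.
move: (levi_act g' (levi_act g'' u)) (levi_act g' (levi_act g w)) => b3 b4.
move: (levi_act g'' (levi_act g v)) (levi_act g'' (levi_act g' u)) => b5 b6.
move: (lie w (levi_act g v)) (lie v (levi_act g w)) => c1 c2.
move: (lie u (levi_act g' w)) (lie w (levi_act g' u)) => c3 c4.
move: (lie v (levi_act g'' u)) (lie u (levi_act g'' v)) => c5 c6.
by apply: heis_eq; last (rewrite /=; ring);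
  apply/matrixP=> i j; rewrite !mxE; ring.
Qed.

HB.instance Definition _ := isLieAlgebra.Build K schrodinger
  schrodinger_lie_linearl schrodinger_lie_linearr schrodinger_liexx
  schrodinger_lie_jacobi.

Definition levi_in (g : sl2 K * so K n) : schrodinger := (g, 0).
Definition heis_in (u : heis K n) : schrodinger := (0, u).

Definition sch_e : schrodinger := levi_in (sl2_e K, 0).
Definition sch_f : schrodinger := levi_in (sl2_f K, 0).
Definition sch_h : schrodinger := levi_in (sl2_h K, 0).
Definition sch_s (i j : 'I_n) : schrodinger := levi_in (0, so_s K i j).
Definition sch_x (i : 'I_n) : schrodinger := heis_in (heis_x K i).
Definition sch_y (i : 'I_n) : schrodinger := heis_in (heis_y K i).
Definition sch_z : schrodinger := heis_in (heis_z K n).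

End Schrodinger.

Section BracketTable.
Variables (K : fieldType) (n : nat).
Implicit Types i j k l : 'I_n.

Local Notation S := (schrodinger K n).
Local Notation e := (sch_e K n).
Local Notation f := (sch_f K n).
Local Notation h := (sch_h K n).
Local Notation s := (@sch_s K n).
Local Notation x := (@sch_x K n).
Local Notation y := (@sch_y K n).
Local Notation z := (sch_z K n).

Lemma schrodinger_eq (p q : S) :
  sl2_mx p.1.1 = sl2_mx q.1.1 -> so_mx p.1.2 = so_mx q.1.2 -> p.2 = q.2 -> p = q.
Proof.
case: p q => [[A B] u] [[A' B'] u'] /= EA EB ->.
by rewrite (val_inj EA : A = A') (val_inj EB : B = B').
Qed.

Lemma lie_levi (g g' : sl2 K * so K n) :
  lie (levi_in g) (levi_in g') = levi_in (lie g g').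
Proof.
apply/eqP; rewrite xpair_eqE /= eqxx /=; apply/eqP.
by rewrite !(linear_map0 (levi_act_linearr _)) subrr add0r
  (linear_map0 (lie_linearr _)).
Qed.

Lemma lie_heis (u v : heis K n) : lie (heis_in u) (heis_in v) = heis_in (lie u v).
Proof.
apply/eqP; rewrite xpair_eqE /= liexx eqxx /=; apply/eqP.
by rewrite !(linear_map0 (levi_act_linearl _)) subrr add0r.
Qed.

Lemma lie_levi_heis (g : sl2 K * so K n) (u : heis K n) :
  lie (levi_in g) (heis_in u) = heis_in (levi_act g u).
Proof.
apply/eqP; rewrite xpair_eqE /= (linear_map0 (lie_linearr _)) eqxx /=; apply/eqP.
by rewrite !(linear_map0 (levi_act_linearl _)) (linear_map0 (lie_linearl _))
  subr0 addr0.
Qed.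

Local Ltac sl2_entries := apply: val_inj;
  apply/matrixP=> [[[|[|//]] ?]] [[|[|//]] ?];
  rewrite /= /mxcomm !mxE !big_ord_recl !big_ord0 !mxE /=; ring.

Lemma sl2_he : lie (sl2_h K) (sl2_e K) = 2%:R *: sl2_e K.
Proof. sl2_entries. Qed.

Lemma sl2_hf : lie (sl2_h K) (sl2_f K) = - (2%:R *: sl2_f K).
Proof. sl2_entries. Qed.

Lemma sl2_ef : lie (sl2_e K) (sl2_f K) = sl2_h K.
Proof. sl2_entries. Qed.

Lemma lie_sl2 (A B : sl2 K) :
  lie (levi_in (A, 0) : S) (levi_in (B, 0)) = levi_in (lie A B, 0).
Proof. by rewrite lie_levi /lie /= /prod_lie /= liexx. Qed.

Lemma lie_he : lie h e = 2%:R *: e.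
Proof. by rewrite lie_sl2 sl2_he; apply: schrodinger_eq; rewrite /= ?scaler0. Qed.

Lemma lie_hf : lie h f = - (2%:R *: f).
Proof.
by rewrite lie_sl2 sl2_hf; apply: schrodinger_eq; rewrite /= ?scaler0 ?oppr0.
Qed.

Lemma lie_ef : lie e f = h.
Proof. by rewrite lie_sl2 sl2_ef. Qed.

Lemma so_ss i j k l : lie (so_s K i j) (so_s K k l) =
  (k == j)%:R *: so_s K i l + (i == l)%:R *: so_s K j k
  + (l == j)%:R *: so_s K k i + (k == i)%:R *: so_s K l j.
Proof.
apply: val_inj; rewrite /= /mxcomm !mulmxBl !mulmxBr !mul_delta_mx_cond.
rewrite !(eq_sym j) !(eq_sym i).
do !case: eqP => _; apply/matrixP=> a b; rewrite !mxE /=; ring.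
Qed.

Lemma lie_ss i j k l : lie (s i j) (s k l) =
  (k == j)%:R *: s i l + (i == l)%:R *: s j k
  + (l == j)%:R *: s k i + (k == i)%:R *: s l j.
Proof.
rewrite lie_levi /lie /= /prod_lie /= liexx so_ss.
by apply: schrodinger_eq; rewrite /= ?scaler0 ?addr0.
Qed.

Lemma lie_sl2_so (A : sl2 K) i j : lie (levi_in (A, 0)) (s i j) = 0.
Proof.
rewrite lie_levi /lie /= /prod_lie /= (linear_map0 (lie_linearl _)).
by rewrite (linear_map0 (lie_linearr _)).
Qed.

Local Ltac levi_entries := rewrite lie_levi_heis; apply: schrodinger_eq;
  rewrite /= ?scaler0 ?oppr0 ?subr0 ?addr0 //; apply: heis_eq;
  rewrite /= ?scaler0 ?oppr0 ?subr0 ?addr0 //; apply/matrixP=> a b;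
  rewrite ?mulmxBl ?mul0mx ?mulmx0 ?mul_delta_mx_cond -?scaler_nat;
  rewrite !mxE /= ?mxE /=; ring.

Lemma lie_hx i : lie h (x i) = x i. Proof. levi_entries. Qed.
Lemma lie_hy i : lie h (y i) = - y i. Proof. levi_entries. Qed.
Lemma lie_ex i : lie e (x i) = 0. Proof. levi_entries. Qed.
Lemma lie_ey i : lie e (y i) = x i. Proof. levi_entries. Qed.
Lemma lie_fx i : lie f (x i) = y i. Proof. levi_entries. Qed.
Lemma lie_fy i : lie f (y i) = 0. Proof. levi_entries. Qed.

Lemma lie_sx k l i :
  lie (s k l) (x i) = (l == i)%:R *: x k - (k == i)%:R *: x l.
Proof. levi_entries. Qed.

Lemma lie_sy k l i :
  lie (s k l) (y i) = (l == i)%:R *: y k - (k == i)%:R *: y l.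
Proof. levi_entries. Qed.

Lemma dotc_delta i j : dotc (delta_mx i 0 : 'cV[K]_n) (delta_mx j 0) = (i == j)%:R.
Proof.
rewrite /dotc (bigD1 i) //= big1 ?addr0 => [|k /negPf ki]; rewrite !mxE ?eqxx.
  by rewrite mul1r andbT.
by rewrite ki mul0r.
Qed.

Local Ltac heis_entries := rewrite lie_heis; apply: schrodinger_eq;
  rewrite /= ?scaler0 //; apply: heis_eq;
  rewrite /= ?scaler0 // ?dotc_delta ?dotc0 ?(dotcC 0) ?dotc0 /GRing.scale /= ?subr0 ?mulr1 //.

Lemma lie_xx i j : lie (x i) (x j) = 0. Proof. heis_entries. Qed.
Lemma lie_yy i j : lie (y i) (y j) = 0. Proof. heis_entries. Qed.
Lemma lie_xy i j : lie (x i) (y j) = (i == j)%:R *: z. Proof. heis_entries. Qed.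

Lemma lie_z (p : S) : lie p z = 0.
Proof.
apply/eqP; rewrite xpair_eqE /= (linear_map0 (lie_linearr _)) eqxx /=; apply/eqP.
rewrite (linear_map0 (levi_act_linearl _)) subr0.
have -> : levi_act p.1 (heis_z K n) = 0.
  by apply: heis_eq; rewrite /= ?scaler0 ?mulmx0 ?addr0.
by rewrite add0r; apply: heis_eq; rewrite /= ?dotc0 ?(dotcC 0) ?dotc0 ?subrr.
Qed.

End BracketTable.

Record lieRep (K : fieldType) (L : lieAlgType K) (M : lmodType K) := LieRep {
  lie_act :> L -> M -> M;
  lie_act_linearl : forall v, linear (lie_act^~ v);
  lie_act_linearr : forall x, linear (lie_act x);
  lie_act_lie : forall x y v,
    lie_act (lie x y) v = lie_act x (lie_act y v) - lie_act y (lie_act x v)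
}.

Section Representations.
Variables (K : fieldType) (L : lieAlgType K) (M : lmodType K).
Variable rho : lieRep L M.

Definition submodule (N : M -> Prop) : Prop :=
  [/\ N 0,
      forall (a : K) u v, N u -> N v -> N (a *: u + v) &
      forall x v, N v -> N (rho x v)].

Definition irreducible_rep : Prop :=
  (exists v : M, v <> 0) /\
  forall N, submodule N -> (forall v, N v -> v = 0) \/ (forall v, N v).

Variable h : L.

Definition weight_space (a : K) (v : M) : Prop := rho h v = a *: v.

(* Spanning and independence: M is the direct sum of its weight spaces. *)
Definition weight_rep : Prop :=
  (forall v, exists (s : seq K) (w : K -> M),
     (forall a, weight_space a (w a)) /\ v = \sum_(a <- s) w a) /\
  (forall (s : seq K) (w : K -> M), uniq s ->
     (forall a, weight_space a (w a)) -> \sum_(a <- s) w a = 0 ->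
     forall a, a \in s -> w a = 0).

Definition finite_dim_subspace (N : M -> Prop) : Prop :=
  exists (d : nat) (b : 'I_d -> M), (forall i, N (b i)) /\
    forall v, N v -> exists c : 'I_d -> K, v = \sum_i c i *: b i.

Definition harish_chandra_rep : Prop :=
  weight_rep /\ forall a, finite_dim_subspace (weight_space a).

End Representations.

Definition rep_iso (K : fieldType) (L : lieAlgType K) (M N : lmodType K)
    (rho : lieRep L M) (sigma : lieRep L N) : Prop :=
  exists phi : M -> N, [/\ linear phi, bijective phi &
    forall x v, phi (rho x v) = sigma x (phi v)].

Section RestrictLevi.
Variables (K : fieldType) (n : nat) (M : lmodType K).
Variable rho : lieRep (schrodinger K n) M.

Definition levi_res_act (g : so K n * sl2 K) : M -> M :=
  rho (levi_in (g.2, g.1)).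

Fact levi_res_linearl v : linear (levi_res_act^~ v).
Proof.
move=> a g g'; rewrite /levi_res_act -(lie_act_linearl rho v a).
by congr (rho _ v); apply: schrodinger_eq; rewrite //= scaler0 addr0.
Qed.

Fact levi_res_linearr g : linear (levi_res_act g).
Proof. exact: lie_act_linearr. Qed.

Fact levi_res_lie g g' v :
  levi_res_act (lie g g') v
  = levi_res_act g (levi_res_act g' v) - levi_res_act g' (levi_res_act g v).
Proof. by rewrite /levi_res_act -lie_act_lie lie_levi. Qed.

Definition levi_res : lieRep (so K n * sl2 K)%type M :=
  LieRep levi_res_linearl levi_res_linearr levi_res_lie.

End RestrictLevi.

(* The tensor product of a finite dimensional V and of an arbitrary W: t stands
   for \sum_i e_i (x) t i, where the e_i are the chosen basis vbasis {:V}; by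
   tensor_universal, tens : V -> W -> tensor V W is the universal bilinear map. *)
Section Tensor.
Variables (K : fieldType) (V : vectType K) (W : lmodType K).

Definition tensor : Type := {ffun 'I_(\dim {:V}) -> W}.
HB.instance Definition _ := GRing.Lmodule.on tensor.

Definition tbasis (i : 'I_(\dim {:V})) : V := (vbasis {:V})`_i.

Definition tens (v : V) (w : W) : tensor := [ffun i => coord (vbasis {:V}) i v *: w].

Lemma tens_linearl w : linear (tens^~ w).
Proof.
by move=> a v v'; apply/ffunP=> i; rewrite !ffunE linearP scalerDl scalerA.
Qed.

Lemma tens_linearr v : linear (tens v).
Proof.
move=> a w w'; apply/ffunP=> i.
by rewrite !ffunE scalerDr !scalerA (mulrC a).
Qed.

Lemma tbasis_sum v : v = \sum_i coord (vbasis {:V}) i v *: tbasis i.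
Proof. exact: coord_vbasis (memvf v). Qed.

Lemma tensor_sum (t : tensor) : t = \sum_i tens (tbasis i) (t i).
Proof.
have fr : free (vbasis {:V}) := basis_free (vbasisP _).
apply/ffunP=> j; rewrite sum_ffunE (bigD1 j) //= big1 ?addr0 => [|i /negPf ij].
  by rewrite ffunE coord_free // eqxx scale1r.
by rewrite ffunE coord_free // ij scale0r.
Qed.

Lemma tensor_universal (U : lmodType K) (f : V -> W -> U) :
  (forall w, linear (f^~ w)) -> (forall v, linear (f v)) ->
  exists g : tensor -> U, [/\ linear g, forall v w, g (tens v w) = f v w &
    forall g' : tensor -> U, linear g' ->
      (forall v w, g' (tens v w) = f v w) -> g' =1 g].
Proof.
move=> fl fr; exists (fun t => \sum_i f (tbasis i) (t i)); split.
- move=> a t t'; rewrite scaler_sumr -big_split; apply: eq_bigr => i _.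
  by rewrite !ffunE fr.
- move=> v w; rewrite [in RHS](tbasis_sum v) (linear_map_sum (fl w)).
  by apply: eq_bigr => i _; rewrite ffunE (linear_mapZ (fl w)) (linear_mapZ (fr _)).
move=> g' g'l g'E t; rewrite [in LHS](tensor_sum t) (linear_map_sum g'l).
by apply: eq_bigr => i _.
Qed.

(* The linear map F (x) G. *)
Definition tensor_map (F : V -> V) (G : W -> W) (t : tensor) : tensor :=
  \sum_i tens (F (tbasis i)) (G (t i)).

Lemma tensor_mapE F G v w : linear F -> linear G ->
  tensor_map F G (tens v w) = tens (F v) (G w).
Proof.
move=> Fl Gl; rewrite /tensor_map [in RHS](tbasis_sum v) (linear_map_sum Fl).
rewrite (linear_map_sum (tens_linearl _)); apply: eq_bigr => i _.
rewrite ffunE (linear_mapZ Gl) (linear_mapZ Fl).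
by rewrite (linear_mapZ (tens_linearl _)) (linear_mapZ (tens_linearr _)).
Qed.

Lemma tensor_map_linear F G : linear G -> linear (tensor_map F G).
Proof.
move=> Gl a t t'; rewrite /tensor_map scaler_sumr -big_split.
by apply: eq_bigr => i _; rewrite !ffunE Gl tens_linearr.
Qed.

Lemma tensor_ext (U : lmodType K) (f g : tensor -> U) : linear f -> linear g ->
  (forall v w, f (tens v w) = g (tens v w)) -> f =1 g.
Proof.
move=> fl gl fg t; rewrite [t]tensor_sum (linear_map_sum fl) (linear_map_sum gl).
exact: eq_bigr.
Qed.

End Tensor.

Section TensorRep.
Variables (K : fieldType) (n : nat) (V : vectType K) (W : lmodType K).
Variables (rho : lieRep (so K n) V) (sigma : lieRep (sl2 K) W).

Definition tensor_act (p : schrodinger K n) (t : tensor V W) : tensor V W :=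
  tensor_map (rho p.1.2) id t + tensor_map id (sigma p.1.1) t.

Lemma tensor_actE p v w :
  tensor_act p (tens v w) = tens (rho p.1.2 v) w + tens v (sigma p.1.1 w).
Proof.
by rewrite /tensor_act !tensor_mapE // => *; apply: lie_act_linearr.
Qed.

Fact tensor_act_linearr p : linear (tensor_act p).
Proof.
move=> a t t'; rewrite /tensor_act !tensor_map_linear //; last first.
  exact: lie_act_linearr.
by rewrite scalerDr addrACA.
Qed.

Fact tensor_act_linearl t : linear (tensor_act^~ t).
Proof.
move=> a p q; rewrite /tensor_act scalerDr addrACA; congr (_ + _).
  rewrite scaler_sumr -big_split; apply: eq_bigr => i _ /=.
  by rewrite lie_act_linearl tens_linearl.
rewrite scaler_sumr -big_split; apply: eq_bigr => i _ /=.
by rewrite lie_act_linearl tens_linearr.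
Qed.

Fact tensor_act_lie p q t :
  tensor_act (lie p q) t
  = tensor_act p (tensor_act q t) - tensor_act q (tensor_act p t).
Proof.
move: t; apply: (tensor_ext (f := tensor_act _)
    (g := fun t => tensor_act p (tensor_act q t) - tensor_act q (tensor_act p t))).
- exact: tensor_act_linearr.
- by move=> a t t'; rewrite !tensor_act_linearr scalerBr opprD addrACA.
move=> v w; rewrite !tensor_actE.
rewrite !(linear_mapD (tensor_act_linearr _)) !tensor_actE /=.
rewrite !lie_act_lie.
rewrite (linear_mapD (tens_linearl _)) (linear_mapN (tens_linearl _)).
rewrite (linear_mapD (tens_linearr _)) (linear_mapN (tens_linearr _)).
set a := tens _ _; set b := tens _ _; set c := tens _ _; set d := tens _ _.
set m1 := tens (rho q.1.2 v) _; set m2 := tens (rho p.1.2 v) _.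
rewrite (addrC m2) (addrACA a m1) (addrC m1 d) (addrACA b) (addrC m2) opprD.
by rewrite (addrACA (a + c)) subrr addr0 opprD addrACA.
Qed.

Definition tensor_rep : lieRep (schrodinger K n) (tensor V W) :=
  LieRep tensor_act_linearl tensor_act_linearr tensor_act_lie.

End TensorRep.

(* Main.v *)
Require Import Defs.
From HB Require Import structures.
From mathcomp Require Import all_boot all_order all_algebra ring.
From mathcomp Require Import complex reals boolp.

Set Implicit Arguments.
Unset Strict Implicit.
Unset Printing Implicit Defensive.

Import GRing.Theory Num.Theory.
Local Open Scope ring_scope.

(* Write x_w, y_w for the elements of h_n attached to w in C^n. As z acts by 0, all of h_n commutes on M,
   and for u in h_n the vectors killed by a power of u form a submodule, so u is locally nilpotent or
   injective on M. If x_w and y_w were both injective, then t = x_w y_w and U = e y_w^2 would act on a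
   nonzero finite dimensional weight space with [U, t] = t^2 and t invertible, and the trace of
   t^-1 [U, t] t^-1 = 1 would be 0. If x_a and y_b were injective, then y_a and x_b would be locally
   nilpotent, so x_(a+b) and y_(a+b) would both be injective. Hence all the x_w or all the y_w are locally
   nilpotent, say the x_w. Suppose that y_w is injective. On the common kernel of the x's,
   x_w^k f^k = (-1)^k k! y_w^k, so the vectors f^k e^k v, which all have the same weight, are independent
   until e^k v = 0: there is v <> 0 of some weight mu killed by e and the x's, and y_w v generates a
   nonzero submodule with weights other than mu, contradicting irreducibility. Thus all of h_n is
   locally nilpotent, and its common kernel is a nonzero submodule, that is, M.
   For the tensor decomposition, let V be a minimal nonzero so_n-submodule of a weight space and
   L = Hom_so_n(V, M). The evaluation V (x) L -> M is onto by irreducibility of M, and injective by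
   Burnside's theorem on V. *)

(** * Coordinates *)

Section Combinations.
Variables (K : fieldType) (M : lmodType K).

Definition subspace (N : M -> Prop) :=
  N 0 /\ forall (a : K) u v, N u -> N v -> N (a *: u + v).

Section Subspace.
Variable N : M -> Prop.
Hypothesis subN : subspace N.

Lemma subspaceZ a u : N u -> N (a *: u).
Proof. by move=> Nu; rewrite -[_ *: _]addr0; apply: subN.2 => //; exact: subN.1. Qed.

Lemma subspaceD u v : N u -> N v -> N (u + v).
Proof. by rewrite -{2}[u]scale1r; exact: subN.2. Qed.

Lemma subspace_sum I (r : seq I) (P : pred I) (F : I -> M) :
  (forall i, P i -> N (F i)) -> N (\sum_(i <- r | P i) F i).
Proof. by move=> NF; elim/big_rec: _ => [|i x Pi]; [exact: subN.1|apply/subspaceD/NF]. Qed.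

End Subspace.

(** Coordinates are row vectors: an operator becomes a matrix multiplied on the right, and
    composites appear in reverse order. *)
Definition lincomb d (b : 'I_d -> M) (c : 'rV[K]_d) : M := \sum_i c 0 i *: b i.

Fact lincomb_is_linear d (b : 'I_d -> M) : linear (lincomb b).
Proof.
move=> a u v; rewrite scaler_sumr -big_split; apply: eq_bigr => i _ /=.
by rewrite !mxE scalerDl scalerA.
Qed.

HB.instance Definition _ d (b : 'I_d -> M) :=
  GRing.isLinear.Build K 'rV[K]_d M *:%R (lincomb b) (lincomb_is_linear b).

Lemma lincomb_delta d (b : 'I_d -> M) i : lincomb b (delta_mx 0 i) = b i.
Proof.
rewrite /lincomb (bigD1 i) //= mxE !eqxx scale1r big1 ?addr0 // => j /negPf ji.
by rewrite mxE ji andbF scale0r.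
Qed.

Lemma lincomb_mul d m (b : 'I_d -> M) (A : 'M[K]_(m, d)) (c : 'rV_m) :
  lincomb b (c *m A) = lincomb (fun i => lincomb b (row i A)) c.
Proof.
rewrite mulmx_sum_row linear_sum; apply: eq_bigr => i _.
by rewrite linearZ.
Qed.

Lemma subspace_lincomb N d (b : 'I_d -> M) c :
  subspace N -> (forall i, N (b i)) -> N (lincomb b c).
Proof. by move=> sN Nb; apply: subspace_sum => // i _; exact: subspaceZ. Qed.

Definition independent d (b : 'I_d -> M) :=
  forall c, lincomb b c = 0 -> c = 0.

Lemma independent_inj d (b : 'I_d -> M) : independent b -> injective (lincomb b).
Proof.
move=> ib c c' /eqP; rewrite -subr_eq0 -linearB => /eqP/ib/eqP.
by rewrite subr_eq0 => /eqP.
Qed.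

Definition spans d (b : 'I_d -> M) (N : M -> Prop) :=
  forall v, N v -> exists c, v = lincomb b c.

(** Induction on the size of a spanning family: a relation with nonzero coefficient at [i] makes
    [b i] redundant. *)
Lemma finite_dim_basis N : finite_dim_subspace N ->
  exists d (b : 'I_d -> M), [/\ forall i, N (b i), independent b & spans b N].
Proof.
case=> d [b [Nb sb]].
have {sb} : spans b N.
  move=> v /sb[c ->]; exists (\row_i c i).
  by apply: eq_bigr => i _; rewrite mxE.
elim: d b Nb => [|d IH] b Nb sb; first by exists 0, b; split=> // c _; rewrite [c]thinmx0.
have [ib|] := pselect (independent b); first by exists d.+1, b.
move=> /existsNP[c /not_implyP[bc0 /eqP/rV0Pn[i ci]]].
apply: (IH (b \o lift i)) => [j|v /sb[v' ->]]; first exact: Nb.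
pose w := v' - (v' 0 i / c 0 i) *: c.
exists (col' i w).
have -> : lincomb b v' = lincomb b w by rewrite linearB linearZ /= bc0 scaler0 subr0.
rewrite /lincomb (bigD1_ord i) //= !mxE divfK // subrr scale0r add0r.
by apply: eq_bigr => j _; rewrite !mxE.
Qed.

(** The coordinates of one vector more than the size of a basis form a matrix with more rows than
    columns, whose left kernel is nonzero. *)
Lemma finite_dim_dependent N : finite_dim_subspace N ->
  exists d, forall w : 'I_d -> M, (forall i, N (w i)) -> ~ independent w.
Proof.
case/finite_dim_basis=> d [b [Nb ib sb]]; exists d.+1 => w Nw iw.
have /choice[c cP] i := sb _ (Nw i).
pose A := \matrix_i c i.
have : kermx A != 0.
  by rewrite kermx_eq0 /row_free neq_ltn ltnS rank_leq_col.
case/rowV0Pn=> u /sub_kermxP uA /eqP; apply; apply: iw.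
have -> : lincomb w u = lincomb b (u *m A).
  by rewrite lincomb_mul; apply: eq_bigr => i _; rewrite rowK -cP.
by rewrite uA linear0.
Qed.

Lemma endo_matrix N d (b : 'I_d -> M) (T : {linear M -> M}) :
  (forall i, N (b i)) -> spans b N -> (forall v, N v -> N (T v)) ->
  exists A, forall c, T (lincomb b c) = lincomb b (c *m A).
Proof.
move=> Nb sb NT; have /choice[a aP] i := sb _ (NT _ (Nb i)).
exists (\matrix_i a i) => c; rewrite lincomb_mul linear_sum.
by apply: eq_bigr => i _; rewrite linearZ rowK -aP.
Qed.

End Combinations.

(** Multiplying the relation by t^-1 on both sides gives E t^-1 - t^-1 E = 1. The left side has
    trace 0, the right side trace d, and the characteristic is 0. *)
Lemma no_unit_commutator_sqr (K : numFieldType) d (t E : 'M[K]_d) :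
  t \in unitmx -> t *m E - E *m t = t *m t -> d = 0%N.
Proof.
move=> ut Et; have : \tr (invmx t *m (t *m E - E *m t) *m invmx t) = 0.
  rewrite mulmxBr mulmxBl !mulmxA mulVmx // mul1mx mulmxK //.
  by rewrite raddfB /= mxtrace_mulC subrr.
rewrite Et mulmxA mulmxK // mulVmx // mxtrace1 => /eqP.
by rewrite pnatr_eq0 => /eqP.
Qed.

Lemma finite_dim_no_commutator_sqr (K : numFieldType) (M : lmodType K)
    (N : M -> Prop) (E t : {linear M -> M}) :
  subspace N -> finite_dim_subspace N ->
  (forall v, N v -> N (E v)) -> (forall v, N v -> N (t v)) ->
  (forall v, N v -> E (t v) - t (E v) = t (t v)) ->
  (forall v, N v -> t v = 0 -> v = 0) -> forall v, N v -> v = 0.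
Proof.
move=> sN /finite_dim_basis[d [b [Nb ib sb]]] NE Nt Et tinj v Nv.
have [A AE] := endo_matrix Nb sb NE; have [B BE] := endo_matrix Nb sb Nt.
have Nl c : N (lincomb b c) by exact: subspace_lincomb.
have [c ->] := sb _ Nv.
suff d0 : d = 0%N by apply: big1 => -[i id]; exfalso; rewrite d0 in id.
(* [B] and [A] are the matrices of [t] and [E]; as row vectors reverse products, E t - t E becomes B
   A - A B. *)
apply: (@no_unit_commutator_sqr _ _ B A).
  rewrite -row_free_unit -kermx_eq0; apply/rowV0P=> u /sub_kermxP uB.
  by apply: ib; apply: tinj => //; rewrite BE uB linear0.
apply/row_matrixP=> i; apply: (independent_inj ib); rewrite !rowE.
by rewrite mulmxBr linearB /= !mulmxA -!(AE, BE) Et.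
Qed.

(** * Weight vectors *)

Section Eigenvectors.
Variables (K : fieldType) (M : lmodType K) (H : {linear M -> M}).

(** Induction on the number of terms: unless the sum v is itself an eigenvector, H v - a v is a
    nonzero element of [N] in which the first term, of weight a, has disappeared. *)
Lemma stable_eigenvector (N : M -> Prop) (s : seq K) (w : K -> M) :
  subspace N -> (forall v, N v -> N (H v)) ->
  (forall a, H (w a) = a *: w a) ->
  N (\sum_(a <- s) w a) -> \sum_(a <- s) w a <> 0 ->
  exists a v, [/\ N v, v <> 0 & H v = a *: v].
Proof.
move=> sN NH; elim: s w => [|a s IH] w wH; first by rewrite big_nil.
set v := \sum_(_ <- _) _ => Nv v0.
have [Hv|Hv] := pselect (H v = a *: v); first by exists a, v.
have E : - a *: v + H v = \sum_(b <- s) (b - a) *: w b.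
  rewrite /v big_cons scalerDr linearD /= wH addrACA -scalerDl addNr scale0r add0r.
  by rewrite !linear_sum -big_split; apply: eq_bigr => b _; rewrite /= wH scalerDl addrC.
apply: (IH (fun b => (b - a) *: w b)) => [b||]; last 2 first.
- by rewrite -E; apply: sN.2 => //; exact: NH.
- by rewrite -E scaleNr addrC => /eqP; rewrite subr_eq0 => /eqP.
by rewrite linearZ /= wH !scalerA mulrC.
Qed.

End Eigenvectors.

Inductive lin_span (K : fieldType) (M : lmodType K) (G : M -> Prop) : M -> Prop :=
| lin_span0 : lin_span G 0
| lin_spanP a u v : G u -> lin_span G v -> lin_span G (a *: u + v).

Section Span.
Variables (K : fieldType) (M : lmodType K) (G : M -> Prop).

Lemma lin_span_subspace : subspace (lin_span G).
Proof.
split=> [|a u v Gu Gv]; first exact: lin_span0.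
elim: Gu => [|b u' v' Gu' _ IH]; first by rewrite scaler0 add0r.
by rewrite scalerDr scalerA -addrA; apply: lin_spanP.
Qed.

Lemma mem_lin_span u : G u -> lin_span G u.
Proof. by move=> Gu; rewrite -[u]addr0 -[u]scale1r; apply: lin_spanP => //; exact: lin_span0. Qed.

Lemma lin_span_stable (T : {linear M -> M}) :
  (forall u, G u -> lin_span G (T u)) -> forall u, lin_span G u -> lin_span G (T u).
Proof.
move=> GT u; elim=> [|a {}u v Gu _ IH]; first by rewrite linear0; exact: lin_span0.
by rewrite linearP; apply: lin_span_subspace.2 => //; exact: GT.
Qed.

(** Serves to show that a submodule spanned by vectors of weights other than [mu] misses a given
    vector of weight [mu]. *)
Lemma lin_span_other_weights (H : {linear M -> M}) mu v :
  (forall u, G u -> exists2 a, a != mu & H u = a *: u) ->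
  lin_span G v -> H v = mu *: v -> v = 0.
Proof.
move=> GH Gv Hv; pose k a u := H u - a *: u.
have kw s a u : H u = a *: u -> foldr k u s = (\prod_(b <- s) (a - b)) *: u.
  move=> Hu; elim: s => [|b s IH] /=; first by rewrite big_nil scale1r.
  by rewrite IH big_cons /k linearZ /= Hu !scalerA -scalerBl (mulrC b) -mulrBr mulrC.
have kP s a u u' : foldr k (a *: u + u') s = a *: foldr k u s + foldr k u' s.
  elim: s => //= b s ->; rewrite /k linearP scalerDr scalerBr opprD addrACA.
  by rewrite !scalerA mulrC.
(* A product of operators [H - b] with [b != mu] kills [v], but acts invertibly on weight mu. *)
have [s mus sv] : exists2 s, mu \notin s & foldr k v s = 0.
  elim: Gv => [|c u u' /GH[a amu Hu] _ [s mus su']].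
    by exists [::].
  exists (a :: s); first by rewrite inE negb_or eq_sym amu.
  rewrite /= kP su' (kw s a u Hu) addr0 scalerA /k [H _]linearZ /= Hu !scalerA.
  by rewrite (mulrC a) subrr.
move: sv; rewrite (kw _ _ _ Hv) => /eqP; rewrite scaler_eq0 prodf_seq_eq0.
case/orP=> [/hasP[b bs]|/eqP//]; rewrite subr_eq0 => /eqP mub.
by rewrite mub bs in mus.
Qed.

End Span.

(** * Locally nilpotent x and injective y *)

Section IterLinear.
Variables (K : fieldType) (M : lmodType K).
Implicit Types T U : {linear M -> M}.

Lemma iter_linear T k : linear (iter k T).
Proof. by elim: k => [|k IH] a u v //=; rewrite IH linearP. Qed.

Lemma iter_commute T U : (forall v, T (U v) = U (T v)) ->
  forall k v, T (iter k U v) = iter k U (T v).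
Proof. by move=> TU; elim=> //= k IH v; rewrite TU IH. Qed.

Lemma iter_injective T : (forall v, T v = 0 -> v = 0) ->
  forall k v, iter k T v = 0 -> v = 0.
Proof. by move=> inj; elim=> //= k IH v /inj/IH. Qed.

Lemma iter_vanish T : (forall v, exists k, iter k T v = 0) ->
  forall v, v <> 0 -> exists k, iter k T v <> 0 /\ T (iter k T v) = 0.
Proof.
move=> nil v v0; have [k] := nil v; elim: k => [|k IH] // kv.
by have [/IH|] := pselect (iter k T v = 0); last exists k.
Qed.

End IterLinear.

(** Only the bracket relations are kept, as identities between linear maps, so that the section
    applies a second time with [E] and [F], [X] and [Y] exchanged and [H] negated. [W] stands for
    the column space, [T] for so_n, and [sw] for the action of so_n on columns. *)
Section HalfNilpotent.
Variables (K : numFieldType) (M : lmodType K) (W T : Type).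
Variables (E F H : {linear M -> M}).
Variables (X Y : W -> {linear M -> M}) (S : T -> {linear M -> M}).
Variable sw : T -> W -> W.

Hypothesis EF : forall v, E (F v) = F (E v) + H v.
Hypothesis HE : forall v, H (E v) = E (H v) + 2%:R *: E v.
Hypothesis HF : forall v, H (F v) = F (H v) - 2%:R *: F v.
Hypothesis HX : forall w v, H (X w v) = X w (H v) + X w v.
Hypothesis HY : forall w v, H (Y w v) = Y w (H v) - Y w v.
Hypothesis EX : forall w v, E (X w v) = X w (E v).
Hypothesis EY : forall w v, E (Y w v) = Y w (E v) + X w v.
Hypothesis FX : forall w v, F (X w v) = X w (F v) + Y w v.
Hypothesis FY : forall w v, F (Y w v) = Y w (F v).
Hypothesis XY : forall w w' v, X w (Y w' v) = Y w' (X w v).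
Hypothesis ES : forall s v, E (S s v) = S s (E v).
Hypothesis FS : forall s v, F (S s v) = S s (F v).
Hypothesis HS : forall s v, H (S s v) = S s (H v).
Hypothesis SX : forall s w v, S s (X w v) = X w (S s v) + X (sw s w) v.

Hypothesis irr : forall N, subspace N ->
  (forall v, N v -> N (E v)) -> (forall v, N v -> N (F v)) ->
  (forall v, N v -> N (H v)) -> (forall w v, N v -> N (X w v)) ->
  (forall w v, N v -> N (Y w v)) -> (forall s v, N v -> N (S s v)) ->
  (forall v, N v -> v = 0) \/ (forall v, N v).
Hypothesis fd : forall a, finite_dim_subspace (fun v => H v = a *: v).
Hypothesis weights : forall v,
  exists (s : seq K) (w : K -> M),
    (forall a, H (w a) = a *: w a) /\ v = \sum_(a <- s) w a.

Local Notation killed v := (forall w, X w v = 0).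

(** Each of the k + 1 exchanges of [X w] with [F] leaves a term -[Y w], and [Y w] commutes with
    [F]. *)
Lemma X_iterF w k v : X w v = 0 ->
  X w (iter k.+1 F v) = - k.+1%:R *: iter k F (Y w v).
Proof.
move=> Xv; have XF u : X w (F u) = F (X w u) - Y w u by rewrite FX addrK.
elim: k => [|k IH].
  by rewrite /= XF Xv linear0 add0r scaleN1r.
rewrite iterS XF IH [F _]linearZ (iter_commute (T := Y w)) // -iterS.
by rewrite -[iter _ F _ in X in _ - X]scale1r -scalerBl -opprD natr1.
Qed.

(** [X_iterF] removes one factor at a time, and [Y w v] is again killed by [X w]; the factors -k
    multiply to the signed factorial. *)
Lemma iterX_iterF w k v : X w v = 0 ->
  iter k (X w) (iter k F v) = ((-1) ^+ k * k`!%:R) *: iter k (Y w) v.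
Proof.
elim: k v => [|k IH] v Xv; first by rewrite /= mulr1 scale1r.
rewrite iterSr X_iterF // (linear_mapZ (@iter_linear _ _ (X w) k)) IH; last by rewrite XY Xv linear0.
rewrite -iterSr scalerA; congr (_ *: _).
by rewrite exprS factS natrM mulN1r !mulNr mulrCA mulrA.
Qed.

(** After j steps only a multiple of [Y w]^j v remains, and [X w] kills it. *)
Lemma iterX_iterF0 w k j v : (j < k)%N -> X w v = 0 -> iter k (X w) (iter j F v) = 0.
Proof.
move=> /subnK <- Xv; rewrite addnS -addSn iterD iterX_iterF //.
rewrite (linear_mapZ (@iter_linear _ _ (X w) _)) iterSr.
by rewrite (iter_commute (T := X w)) // Xv !(linear_map0 (@iter_linear _ _ _ _)) scaler0.
Qed.

Lemma H_iterE a k v : H v = a *: v -> H (iter k E v) = (a + 2 * k%:R) *: iter k E v.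
Proof.
move=> Hv; elim: k => [|k IH]; first by rewrite mulr0 addr0.
by rewrite iterS HE IH linearZ -scalerDl; congr (_ *: _); ring.
Qed.

Lemma H_iterF a k v : H v = a *: v -> H (iter k F v) = (a - 2 * k%:R) *: iter k F v.
Proof.
move=> Hv; elim: k => [|k IH]; first by rewrite mulr0 subr0.
by rewrite iterS HF IH linearZ -scalerBl; congr (_ *: _); ring.
Qed.

(** The usual highest weight computation for sl_2, with the scalar left existential since only
    membership in a span is at stake. *)
Lemma E_iterF a k v : H v = a *: v -> E v = 0 ->
  exists c, E (iter k.+1 F v) = c *: iter k F v.
Proof.
move=> Hv Ev; elim: k => [|k [c IH]]; first by exists a; rewrite /= EF Ev linear0 add0r.
exists (c + (a - 2 * k.+1%:R)).
by rewrite iterS EF IH (H_iterF k.+1 Hv) linearZ [RHS]scalerDl.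
Qed.

Lemma killedE v : killed v -> killed (E v).
Proof. by move=> kv w; rewrite -EX kv linear0. Qed.

Lemma killedY w v : killed v -> killed (Y w v).
Proof. by move=> kv w'; rewrite XY kv linear0. Qed.

(* The vectors [F^k E^k v] all have the same weight, and they are independent as long as they are nonzero. *)
Lemma killed_top w a v : (forall u, Y w u = 0 -> u = 0) -> killed v -> v <> 0 ->
  H v = a *: v -> exists b u, [/\ killed u, E u = 0, H u = b *: u & u <> 0].
Proof.
move=> Yinj kv v0 Hv; have [d dP] := finite_dim_dependent (fd a).
have kE k : killed (iter k E v) by elim: k => //= k; exact: killedE.
suff [k [kv0 kv1]] : exists k, iter k E v <> 0 /\ E (iter k E v) = 0.
  by exists (a + 2 * k%:R), (iter k E v); split=> //; exact: H_iterE.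
apply: contrapT => /forallNP Env.
have Ev0 k : iter k E v <> 0.
  by elim: k => [|k IH] //= Ev; apply: (Env k).
pose b (i : 'I_d) := iter i F (iter i E v).
apply: (dP b) => [i|c bc].
  by rewrite /b (H_iterF _ (H_iterE _ Hv)) addrK.
apply/rowP=> i; rewrite [RHS]mxE.
(* The coefficients vanish from the last index down: [X w]^i kills the terms below i, those above i
   are zero by induction, and term i becomes c_i i! [Y w]^i E^i v up to sign. *)
have [m] := ubnP (d - i); elim: m i => // m IH i im; apply/eqP/negPn/negP => ci.
have : iter i (X w) (lincomb b c) = c 0 i *: iter i (X w) (b i).
  rewrite /lincomb (linear_map_sum (@iter_linear _ _ _ _)) (bigD1 i) //=.
  rewrite (linear_mapZ (@iter_linear _ _ _ _)) big1 ?addr0 // => j ji.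
  rewrite (linear_mapZ (@iter_linear _ _ _ _)).
  have [jlti|ilej] := ltnP j i; first by rewrite iterX_iterF0 ?scaler0.
  rewrite IH ?scale0r //; have : (i < j)%N by rewrite ltn_neqAle eq_sym ji.
  by move=> ij; apply: leq_trans (_ : d - j < d - i)%N im; rewrite ltn_sub2l.
rewrite bc (linear_map0 (@iter_linear _ _ _ _)) iterX_iterF // scalerA => /esym/eqP.
rewrite scaler_eq0 !mulf_eq0 (negPf ci) signr_eq0 pnatr_eq0 eqn0Ngt fact_gt0 /=.
by move=> /eqP/(iter_injective Yinj); exact: Ev0.
Qed.

Lemma half_nilpotent w v0 : v0 <> 0 -> killed v0 -> ~ (forall u, Y w u = 0 -> u = 0).
Proof.
move=> v00 k0 Yinj.
(* The common kernel of the [X w] is stable under [H], hence contains a weight vector. *)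
have sk : subspace (fun v => killed v).
  by split=> [w'|a u v ku kv w']; rewrite ?linear0 // linearP ku kv scaler0 addr0.
have kH v : killed v -> killed (H v).
  by move=> kv w'; have := HX w' v; rewrite kv linear0 addr0.
have [s [wt [wtH v0E]]] := weights v0.
have [||a [u [ku u0 Hu]]] := @stable_eigenvector _ _ H _ s wt sk kH wtH; rewrite -?v0E //.
have {a u ku u0 Hu}[mu [v [kv Ev Hv nv]]] := killed_top Yinj ku u0 Hu.
pose hwv a u := [/\ killed u, E u = 0 & H u = a *: u].
have hwvY b a u : hwv a u -> hwv (a - 1) (Y b u).
  move=> [ku Eu Hu]; split; first exact: killedY.
    by rewrite EY Eu ku linear0 addr0.
  by rewrite HY Hu linearZ scalerBl scale1r.
(* The weights of these generators are mu - (i + 1) - 2k, never mu. Their span contains [Y w v],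
   nonzero by injectivity, but not [v], so it contradicts irreducibility once it is shown to be
   stable. *)
pose G x := exists k i u, x = iter k F u /\ hwv (mu - i.+1%:R) u.
have sG := lin_span_subspace G.
have GH x : G x -> exists2 a, a != mu & H x = a *: x.
  move=> [k [i [u [-> [_ _ Hu]]]]]; exists (mu - i.+1%:R - 2 * k%:R); last exact: H_iterF.
  rewrite -natrM -addrA -opprD -natrD addSn -subr_eq0 addrAC subrr add0r oppr_eq0.
  by rewrite pnatr_eq0.
have [] := irr sG.
- apply: lin_span_stable => _ [[|k] [i [u [-> [ku Eu Hu]]]]].
    by rewrite /= Eu; exact: sG.1.
  have [c ->] := E_iterF k Hu Eu; apply: subspaceZ => //; apply: mem_lin_span.
  by exists k, i, u.
- apply: lin_span_stable => _ [k [i [u [-> uP]]]]; apply: mem_lin_span.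
  by exists k.+1, i, u.
- apply: lin_span_stable => x Gx; have [a _ ->] := GH _ Gx.
  by apply: subspaceZ => //; exact: mem_lin_span.
(* By [X_iterF], X_b F^(k+1) u is a multiple of F^k (Y_b u), and Y_b u is a vector of the same kind
   with weight lowered by one. *)
- move=> b; apply: lin_span_stable => _ [[|k] [i [u [-> uP]]]].
    by case: uP => [ku _ _]; rewrite /= ku; exact: sG.1.
  rewrite X_iterF; last by case: uP.
  apply: subspaceZ => //; apply: mem_lin_span; exists k, i.+1, (Y b u); split=> //.
  by rewrite -natr1 opprD addrA; exact: hwvY.
- move=> b; apply: lin_span_stable => _ [k [i [u [-> uP]]]]; apply: mem_lin_span.
  exists k, i.+1, (Y b u); split; first by rewrite iter_commute.
  by rewrite -natr1 opprD addrA; exact: hwvY.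
- move=> r; apply: lin_span_stable => _ [k [i [u [-> [ku Eu Hu]]]]]; apply: mem_lin_span.
  exists k, i, (S r u); split; first by rewrite iter_commute.
  split; last 2 first.
  + by rewrite ES Eu linear0.
  + by rewrite HS Hu linearZ.
  by move=> b; have := SX r b u; rewrite !ku linear0 addr0.
- move=> /(_ (Y w v)) Yv0; apply: nv; apply: Yinj; apply: Yv0; apply: mem_lin_span.
  by exists 0, 0, (Y w v); split=> //; exact: hwvY.
- by move=> /(_ v) /(lin_span_other_weights GH) /(_ Hv).
Qed.

End HalfNilpotent.

(** * Brackets in the Schrodinger algebra *)

HB.instance Definition _ (K : fieldType) (L : lieAlgType K) (M : lmodType K)
    (rho : lieRep L M) (x : L) :=
  GRing.isLinear.Build K M M *:%R (lie_act rho x) (lie_act_linearr rho x).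

Section ActionFacts.
Variables (K : fieldType) (L : lieAlgType K) (M : lmodType K).
Variable rho : lieRep L M.

Lemma lie_actC p q v : rho p (rho q v) = rho q (rho p v) + rho (lie p q) v.
Proof. by rewrite lie_act_lie addrC subrK. Qed.

Lemma lie_actDl p q v : rho (p + q) v = rho p v + rho q v.
Proof. exact: linear_mapD (lie_act_linearl rho v) p q. Qed.

Lemma lie_actZl a p v : rho (a *: p) v = a *: rho p v.
Proof. exact: linear_mapZ (lie_act_linearl rho v) a p. Qed.

Lemma lie_act0l v : rho 0 v = 0.
Proof. exact: linear_map0 (lie_act_linearl rho v). Qed.

Lemma lie_actNl p v : rho (- p) v = - rho p v.
Proof. exact: linear_mapN (lie_act_linearl rho v) p. Qed.

Lemma submodule_subspace N : submodule rho N -> subspace N.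
Proof. by case. Qed.

End ActionFacts.

Lemma sl2_decomp (K : fieldType) (A : sl2 K) :
  A = sl2_mx A 0 0 *: sl2_h K + sl2_mx A 0 1 *: sl2_e K + sl2_mx A 1 0 *: sl2_f K.
Proof.
have A11 : sl2_mx A 1 1 = - sl2_mx A 0 0.
  have /eqP := sl2P A; rewrite /mxtrace !big_ord_recl big_ord0 addr0.
  rewrite (_ : lift ord0 ord0 = 1); last exact: val_inj.
  by move=> /eqP; rewrite addr_eq0 => /eqP ->; rewrite opprK.
apply: val_inj; apply/matrixP=> i j; rewrite !mxE /=.
case: i j => [[|[|//]] i2] [[|[|//]] j2] /=;
  rewrite !(mulr0, mulr1, subr0, addr0, add0r, sub0r, mulrN1).
- by congr (sl2_mx A _ _); exact: val_inj.
- by congr (sl2_mx A _ _); exact: val_inj.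
- by congr (sl2_mx A _ _); exact: val_inj.
- by rewrite -A11; congr (sl2_mx A _ _); exact: val_inj.
Qed.

Section LeviActions.
Variables (K : fieldType) (n : nat).
Implicit Types (w : 'cV[K]_n) (s : so K n).

Definition hx w : schrodinger K n := heis_in (w, 0, 0).
Definition hy w : schrodinger K n := heis_in (0, w, 0).
Definition so_in s : schrodinger K n := levi_in (0, s).

Local Ltac levi_entries := rewrite lie_levi_heis /levi_act /hx /hy /= !mxE /=
  ?(scale1r, scale0r, scaleN1r, scaler0, mul0mx, mulmx0, add0r, addr0, sub0r, subr0, oppr0, scaleNr).

Lemma lie_h_hx w : lie (sch_h K n) (hx w) = hx w. Proof. by levi_entries. Qed.
Lemma lie_h_hy w : lie (sch_h K n) (hy w) = - hy w.
Proof.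
by levi_entries; apply: schrodinger_eq; rewrite /= ?oppr0 //; apply: heis_eq; rewrite /= ?oppr0.
Qed.
Lemma lie_e_hx w : lie (sch_e K n) (hx w) = 0. Proof. by levi_entries. Qed.
Lemma lie_e_hy w : lie (sch_e K n) (hy w) = hx w. Proof. by levi_entries. Qed.
Lemma lie_f_hx w : lie (sch_f K n) (hx w) = hy w. Proof. by levi_entries. Qed.
Lemma lie_f_hy w : lie (sch_f K n) (hy w) = 0. Proof. by levi_entries. Qed.
Lemma lie_so_hx s w : lie (so_in s) (hx w) = hx (so_mx s *m w).
Proof. by levi_entries. Qed.
Lemma lie_so_hy s w : lie (so_in s) (hy w) = hy (so_mx s *m w).
Proof. by levi_entries. Qed.

Lemma lie_sl2_so_in (A : sl2 K) s : lie (levi_in (A, 0)) (so_in s) = 0.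
Proof.
by rewrite lie_levi /lie /= /prod_lie /= (linear_map0 (lie_linearl _)) (linear_map0 (lie_linearr _)).
Qed.

Lemma schrodinger_decomp (p : schrodinger K n) : p = levi_in p.1 + heis_in p.2.
Proof.
by case: p => g u; apply/eqP; rewrite xpair_eqE /= addr0 add0r !eqxx.
Qed.

Lemma levi_decomp (g : sl2 K * so K n) : levi_in g = levi_in (g.1, 0) + so_in g.2.
Proof.
by case: g => A s; apply/eqP; rewrite xpair_eqE /= addr0 eqxx andbT xpair_eqE /= addr0 add0r !eqxx.
Qed.

Lemma levi_sl2_decomp (A : sl2 K) : levi_in (A, 0) =
  sl2_mx A 0 0 *: sch_h K n + sl2_mx A 0 1 *: sch_e K n + sl2_mx A 1 0 *: sch_f K n.
Proof.
rewrite [A in LHS]sl2_decomp; apply/eqP; rewrite xpair_eqE /= !scaler0 !addr0 eqxx andbT.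
by rewrite xpair_eqE /= !scaler0 !addr0 !eqxx.
Qed.

Lemma heis_decomp (u : heis K n) : heis_in u = hx u.1.1 + hy u.1.2 + (u.2 : K) *: sch_z K n.
Proof.
apply/eqP; rewrite xpair_eqE /= scaler0 !addr0 eqxx /=; apply/eqP; apply: heis_eq => /=.
- by rewrite scaler0 !addr0.
- by rewrite scaler0 add0r addr0.
by rewrite /GRing.scale /= mulr1 !add0r.
Qed.

Lemma hx_linear : linear hx.
Proof.
move=> a u v; apply/eqP; rewrite xpair_eqE /= scaler0 addr0 eqxx /=.
by apply/eqP/heis_eq; rewrite /= ?scaler0 ?addr0.
Qed.

Lemma hy_linear : linear hy.
Proof.
move=> a u v; apply/eqP; rewrite xpair_eqE /= scaler0 addr0 eqxx /=.
by apply/eqP/heis_eq; rewrite /= ?scaler0 ?addr0.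
Qed.

Lemma linear_col_sum (V : lmodType K) (f : 'cV[K]_n -> V) w :
  linear f -> f w = \sum_i w i 0 *: f (delta_mx i 0).
Proof.
move=> lf; rewrite [w in LHS]matrix_sum_delta (linear_map_sum lf).
by apply: eq_bigr => i _; rewrite big_ord1 (linear_mapZ lf).
Qed.

(** The ideal property of h_n, from which local nilpotency and common kernels pass to submodules. *)
Lemma lie_in_heis p (u : heis K n) : exists u', lie p (heis_in u) = heis_in u'.
Proof.
exists (levi_act p.1 u + lie p.2 u).
rewrite {1}[p]schrodinger_decomp (linear_mapD (lie_linearl _)) lie_levi_heis lie_heis.
by apply/eqP; rewrite xpair_eqE /= addr0 !eqxx.
Qed.

End LeviActions.

(** * The Heisenberg algebra acts by zero *)

Section CentreActsByZero.
Variables (K : numFieldType) (n : nat) (M : lmodType K).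
Variable rho : lieRep (schrodinger K n) M.
Hypothesis M_irr : irreducible_rep rho.
Hypothesis M_hc : harish_chandra_rep rho (sch_h K n).
Hypothesis z_act0 : forall v : M, rho (sch_z K n) v = 0.

Local Notation E := (rho (sch_e K n)).
Local Notation F := (rho (sch_f K n)).
Local Notation H := (rho (sch_h K n)).
Local Notation X w := (rho (hx w)).
Local Notation Y w := (rho (hy w)).

(** The bracket of two elements of h_n is a multiple of z. *)
Lemma heis_commute (u u' : heis K n) v :
  rho (heis_in u) (rho (heis_in u') v) = rho (heis_in u') (rho (heis_in u) v).
Proof.
have x0 : hx (lie u u').1.1 = 0 := linear_map0 (@hx_linear K n).
have y0 : hy (lie u u').1.2 = 0 := linear_map0 (@hy_linear K n).
by rewrite lie_actC lie_heis (heis_decomp (lie _ _)) x0 y0 !add0r lie_actZl z_act0 scaler0 addr0.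
Qed.

Definition nilpotent_on (p : schrodinger K n) := forall v, exists k, iter k (rho p) v = 0.
Definition injective_on (p : schrodinger K n) := forall v, rho p v = 0 -> v = 0.

(** With u' = [p, u], which commutes with u on M, one has u^(j+1) p = p u^(j+1) - (j+1) u' u^j, so
    the vectors killed by a power of u form a submodule. If it is zero, u is injective. *)
Lemma heis_nilpotent_or_injective (u : heis K n) :
  nilpotent_on (heis_in u) \/ injective_on (heis_in u).
Proof.
pose N v := exists k, iter k (rho (heis_in u)) v = 0.
have itl k : linear (iter k (rho (heis_in u))) by exact: iter_linear.
have [|N0|] := M_irr.2 N; last 2 first.
- by right=> v v0; apply: N0; exists 1.
- by left.
split=> [|a v v' [k kv] [k' kv']|p v [k kv]].
- by exists 0.
- exists (k + k')%N; rewrite itl {1}addnC !iterD kv kv' !(linear_map0 (itl _)).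
  by rewrite scaler0 addr0.
have [u' u'E] := lie_in_heis p u.
have step j : iter j.+1 (rho (heis_in u)) (rho p v) =
    rho p (iter j.+1 (rho (heis_in u)) v)
    - j.+1%:R *: rho (heis_in u') (iter j (rho (heis_in u)) v).
  have swap x : rho (heis_in u) (rho p x) =
      rho p (rho (heis_in u) x) - rho (heis_in u') x.
    by rewrite (lie_actC rho p) u'E addrK.
  elim: j => [|j IH]; first by rewrite /= swap scale1r.
  rewrite iterS IH linearB linearZ /= swap (heis_commute u u') -addrA -opprD; congr (_ - _).
  by rewrite -{1}(scale1r (rho (heis_in u') _)) -scalerDl nat1r.
by exists k.+1; rewrite step iterS kv !(linear0, subr0).
Qed.

Lemma M_decomp v : exists (s : seq K) (w : K -> M),
  (forall a, H (w a) = a *: w a) /\ v = \sum_(a <- s) w a.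
Proof. exact: M_hc.1.1. Qed.

Lemma nonzero_weight_vector : exists a v, v <> 0 /\ H v = a *: v.
Proof.
have [v0 v00] := M_irr.1; have [s [w [wH v0E]]] := M_decomp v0.
have sT : subspace (fun _ : M => True) by [].
have [//||a [v [_ nv Hv]]] := stable_eigenvector (H := H) (s := s) sT (fun _ _ => I) wH.
  by rewrite -v0E.
by exists a, v.
Qed.

Lemma H_X w v a : H v = a *: v -> H (X w v) = (a + 1) *: X w v.
Proof. by move=> Hv; rewrite lie_actC Hv linearZ lie_h_hx scalerDl scale1r. Qed.

Lemma H_Y w v a : H v = a *: v -> H (Y w v) = (a - 1) *: Y w v.
Proof. by move=> Hv; rewrite lie_actC Hv linearZ lie_h_hy lie_actNl scalerBl scale1r. Qed.

Lemma H_E v a : H v = a *: v -> H (E v) = (a + 2) *: E v.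
Proof. by move=> Hv; rewrite lie_actC Hv linearZ lie_he lie_actZl scalerDl. Qed.

Lemma weight_space_subspace a : subspace (weight_space rho (sch_h K n) a).
Proof.
split=> [|b u v Hu Hv]; rewrite /weight_space ?linear0 ?scaler0 //.
by rewrite lie_act_linearr Hu Hv scalerDr !scalerA mulrC.
Qed.

(* With [t = X_w Y_w] and [U = E Y_w^2], both of weight 0, one has [[U, t] = t^2]. *)
Lemma not_both_injective w : injective_on (hx w) -> ~ injective_on (hy w).
Proof.
move=> Xinj Yinj; have [a [v [nv Hv]]] := nonzero_weight_vector; apply: nv.
pose t : {linear M -> M} := (X w \o Y w : {linear M -> M}).
pose U : {linear M -> M} := (E \o (Y w \o Y w) : {linear M -> M}).
apply: (@finite_dim_no_commutator_sqr K M _ U t (weight_space_subspace a)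
  (M_hc.2 a)); rewrite /weight_space //=.
- by move=> u /(H_Y w)/(H_Y w)/H_E ->; congr (_ *: _); ring.
- by move=> u /(H_Y w)/(H_X w) ->; rewrite subrK.
- move=> u _; have XY x : X w (Y w x) = Y w (X w x) by exact: heis_commute.
  rewrite -!XY (lie_actC rho (sch_e K n)) lie_e_hx lie_act0l addr0.
  rewrite (lie_actC rho (sch_e K n) (hy w) (rho (hy w) (rho (hy w) u))) lie_e_hy.
  by rewrite linearD /= addrAC subrr add0r.
- by move=> u _ /Xinj/Yinj.
Qed.

(** If (u + u') v = 0, then u^(k+1) v = -u' u^k v, so injectivity of u' lowers the exponent killing
    v down to 0. *)
Lemma nilpotent_injective_add (u u' : heis K n) :
  nilpotent_on (heis_in u) -> injective_on (heis_in u') ->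
  injective_on (heis_in u + heis_in u').
Proof.
move=> nil inj v; rewrite lie_actDl => /eqP; rewrite addr_eq0 => /eqP uv.
have [k kv] := nil v; elim: k kv => // k IH kv; apply: IH.
apply: inj; rewrite -[iter k _ v]/(iter k (rho (heis_in u)) v).
rewrite (iter_commute (T := rho (heis_in u'))) => [|x]; last exact: heis_commute.
move: kv; rewrite iterSr uv (linear_mapN (@iter_linear _ _ _ _)) => /eqP.
by rewrite oppr_eq0 => /eqP.
Qed.

Lemma all_X_or_all_Y_nilpotent :
  (forall w, nilpotent_on (hx w)) \/ (forall w, nilpotent_on (hy w)).
Proof.
have dx w : nilpotent_on (hx w) \/ injective_on (hx w) := heis_nilpotent_or_injective _.
have dy w : nilpotent_on (hy w) \/ injective_on (hy w) := heis_nilpotent_or_injective _.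
have [|/existsNP[a na]] := pselect (forall w, nilpotent_on (hx w)); first by left.
right=> b; have [//|yb] := dy b; exfalso.
have [//|xa] := dx a.
have [ya|/(not_both_injective xa)//] := dy a.
have [xb|/not_both_injective/(_ yb)//] := dx b.
(* At this point x_a and y_b are injective, x_b and y_a locally nilpotent. *)
apply: (@not_both_injective (b + a)).
  by rewrite (linear_mapD (@hx_linear _ _)); exact: nilpotent_injective_add.
by rewrite addrC (linear_mapD (@hy_linear _ _)); exact: nilpotent_injective_add.
Qed.

(** The last nonzero iterate of u on a vector is killed by u, and stays killed by the other elements
    because they commute with u. *)
Lemma common_kernel (r : seq (heis K n)) :
  (forall u, u \in r -> nilpotent_on (heis_in u)) ->
  exists2 v : M, v <> 0 & forall u, u \in r -> rho (heis_in u) v = 0.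
Proof.
elim: r => [_|u r IH nil]; first by have [v] := M_irr.1; exists v.
have [|v nv rv] := IH; first by move=> x xr; apply: nil; rewrite inE xr orbT.
have [k [kv ukv]] := iter_vanish (nil u (mem_head _ _)) nv.
exists (iter k (rho (heis_in u)) v) => // x; rewrite inE => /predU1P[->//|xr].
rewrite (iter_commute (T := rho (heis_in x))) => [|y]; last exact: heis_commute.
by rewrite /= rv // (linear_map0 (@iter_linear _ _ _ _)).
Qed.

Lemma common_kernel_col (f : 'cV[K]_n -> schrodinger K n) :
  linear f -> (forall w, exists u, f w = heis_in u) ->
  (forall w, nilpotent_on (f w)) ->
  exists2 v : M, v <> 0 & forall w, rho (f w) v = 0.
Proof.
move=> lf fh nil; have /choice[g gE] := fh.
have [u|v nv vP] := @common_kernel [seq g (delta_mx i 0) | i : 'I_n].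
  by case/mapP=> i _ ->; rewrite -gE.
exists v => // w; rewrite (linear_col_sum w lf) (linear_map_sum (lie_act_linearl rho v)).
by apply: big1 => i _; rewrite lie_actZl gE vP ?scaler0 // map_f // mem_enum.
Qed.

Lemma submodule_generators N : subspace N ->
  (forall v, N v -> N (E v)) -> (forall v, N v -> N (F v)) ->
  (forall v, N v -> N (H v)) -> (forall w v, N v -> N (X w v)) ->
  (forall w v, N v -> N (Y w v)) -> (forall s v, N v -> N (rho (so_in s) v)) ->
  submodule rho N.
Proof.
move=> sN NE NF NH NX NY NS; split=> [||p v Nv]; [exact: sN.1|exact: sN.2|].
rewrite [p]schrodinger_decomp levi_decomp levi_sl2_decomp heis_decomp.
rewrite !lie_actDl !lie_actZl z_act0 scaler0 addr0.
do !apply: subspaceD => //; try apply: subspaceZ => //;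
  by [exact: NE|exact: NF|exact: NH|exact: NX|exact: NY|exact: NS].
Qed.

Lemma all_Y_nilpotent :
  (forall w, nilpotent_on (hx w)) -> forall w, nilpotent_on (hy w).
Proof.
move=> nilX w; have [//|yw] := heis_nilpotent_or_injective (0, w, 0); exfalso.
have [|v nv kv] := common_kernel_col (@hx_linear _ _) _ nilX.
  by move=> b; exists (b, 0, 0).
apply: (@half_nilpotent K M 'cV[K]_n (so K n) E F H (fun w => X w) (fun w => Y w)
  (fun s => rho (so_in s)) (fun s w => so_mx s *m w)) nv kv yw => /=.
- by move=> x; rewrite lie_actC lie_ef.
- by move=> x; rewrite lie_actC lie_he lie_actZl.
- by move=> x; rewrite lie_actC lie_hf lie_actNl lie_actZl.
- by move=> b x; rewrite lie_actC lie_h_hx.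
- by move=> b x; rewrite lie_actC lie_h_hy lie_actNl.
- by move=> b x; rewrite lie_actC lie_e_hx lie_act0l addr0.
- by move=> b x; rewrite lie_actC lie_e_hy.
- by move=> b x; rewrite lie_actC lie_f_hx.
- by move=> b x; rewrite lie_actC lie_f_hy lie_act0l addr0.
- by move=> b b' x; exact: heis_commute.
- by move=> s x; rewrite lie_actC lie_sl2_so_in lie_act0l addr0.
- by move=> s x; rewrite lie_actC lie_sl2_so_in lie_act0l addr0.
- by move=> s x; rewrite lie_actC lie_sl2_so_in lie_act0l addr0.
- by move=> s b x; rewrite lie_actC lie_so_hx.
- by move=> N *; apply: M_irr.2; exact: submodule_generators.
- exact: M_hc.2.
- exact: M_decomp.
Qed.

(* The bracket relations are invariant under E <-> F, H <-> -H, X <-> Y. *)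
Lemma all_X_nilpotent :
  (forall w, nilpotent_on (hy w)) -> forall w, nilpotent_on (hx w).
Proof.
move=> nilY w; have [//|xw] := heis_nilpotent_or_injective (w, 0, 0); exfalso.
have [|v nv kv] := common_kernel_col (@hy_linear _ _) _ nilY.
  by move=> b; exists (0, b, 0).
pose H' : {linear M -> M} := rho (- sch_h K n).
have H'E x : H' x = - H x by exact: lie_actNl.
apply: (@half_nilpotent K M 'cV[K]_n (so K n) F E H' (fun w => Y w) (fun w => X w)
  (fun s => rho (so_in s)) (fun s w => so_mx s *m w)) nv kv xw => /=.
- by move=> x; rewrite H'E [in RHS]lie_actC lie_ef addrK.
- by move=> x; rewrite !H'E lie_actC linearN lie_hf lie_actNl lie_actZl opprB addrC.
- by move=> x; rewrite !H'E lie_actC linearN lie_he lie_actZl opprD.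
- by move=> b x; rewrite !H'E lie_actC linearN lie_h_hy lie_actNl opprB addrC.
- by move=> b x; rewrite !H'E lie_actC linearN lie_h_hx opprD.
- by move=> b x; rewrite lie_actC lie_f_hy lie_act0l addr0.
- by move=> b x; rewrite lie_actC lie_f_hx.
- by move=> b x; rewrite lie_actC lie_e_hy.
- by move=> b x; rewrite lie_actC lie_e_hx lie_act0l addr0.
- by move=> b b' x; exact: heis_commute.
- by move=> s x; rewrite lie_actC lie_sl2_so_in lie_act0l addr0.
- by move=> s x; rewrite lie_actC lie_sl2_so_in lie_act0l addr0.
- by move=> s x; rewrite !H'E lie_actC lie_sl2_so_in lie_act0l addr0 linearN.
- by move=> s b x; rewrite lie_actC lie_so_hy.
- move=> N sN NF NE NH NY NX NS; apply: M_irr.2; apply: submodule_generators => // x Nx.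
  by rewrite -[H x]opprK -H'E -scaleN1r; apply: subspaceZ => //; exact: NH.
- move=> a; have [d [b [bP sb]]] := M_hc.2 (- a).
  exists d, b; split=> [i|x Hx]; first by rewrite H'E bP scaleNr opprK.
  by apply: sb; rewrite /weight_space scaleNr -Hx H'E opprK.
- move=> x; have [s [wt [wtH ->]]] := M_decomp x.
  exists (map -%R s), (wt \o -%R); split=> [a|]; first by rewrite H'E /= wtH scaleNr opprK.
  by rewrite big_map; apply: eq_bigr => a _; rewrite /= opprK.
Qed.

Theorem heis_act0 u v : rho (heis_in u) v = 0.
Proof.
have [nx ny] : (forall w, nilpotent_on (hx w)) /\ (forall w, nilpotent_on (hy w)).
  have [n1|n1] := all_X_or_all_Y_nilpotent; split=> //.
    exact: all_Y_nilpotent.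
  exact: all_X_nilpotent.
pose N v := forall u, rho (heis_in u) v = 0.
(* The common kernel of h_n is a submodule because h_n is an ideal; [common_kernel], applied to the
   x_i and y_i, shows that it is nonzero. *)
have [|N0|/(_ v)/(_ u)//] := M_irr.2 N.
  split=> [x|a x y Nx Ny b|p x Nx b]; first by rewrite linear0.
    by rewrite lie_act_linearr Nx Ny scaler0 addr0.
  have [b' bE] := lie_in_heis p b.
  by have := lie_actC rho p (heis_in b) x; rewrite bE !Nx linear0 addr0.
pose r : seq (heis K n) := [seq (delta_mx i 0, 0, 0) | i : 'I_n] ++
  [seq (0, delta_mx i 0, 0) | i : 'I_n].
have [x|x nx0 xP] := @common_kernel r.
  by rewrite mem_cat => /orP[] /mapP[i _ ->]; [exact: nx|exact: ny].
case: nx0; apply: N0 => b; rewrite heis_decomp !lie_actDl lie_actZl z_act0 scaler0 addr0.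
rewrite (linear_col_sum b.1.1 (@hx_linear _ _)) (linear_col_sum b.1.2 (@hy_linear _ _)).
rewrite !(linear_map_sum (lie_act_linearl rho x)) !big1 ?addr0 // => i _;
  rewrite lie_actZl xP ?scaler0 // mem_cat; apply/orP; [right|left];
  by apply: map_f; rewrite mem_enum.
Qed.

End CentreActsByZero.

(** * Burnside's theorem *)

Lemma exists_row_neq0 (K : fieldType) m d (A : 'M[K]_(m, d)) :
  A != 0 -> exists i, row i A != 0.
Proof.
move=> A0; apply/existsP; apply: contraR A0; rewrite negb_exists => /forallP A0.
by apply/eqP/row_matrixP=> i; rewrite row0; apply/eqP; move: (A0 i); rewrite negbK.
Qed.

(** Choose [U] of maximal rank with row space inside [P]: adding a further vector of [P] cannot
    raise the rank. *)
Lemma subspace_rowspace (K : fieldType) d (P : 'rV[K]_d -> Prop) :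
  subspace P -> exists U : 'M[K]_d, forall v, P v <-> (v <= U)%MS.
Proof.
move=> sP; pose Q k := `[< exists2 U : 'M[K]_d, \rank U = k & forall v, (v <= U)%MS -> P v >].
have Q0 : exists k, Q k.
  exists 0; apply/asboolP; exists 0; first exact: mxrank0.
  by move=> v; rewrite submx0 => /eqP ->; exact: sP.1.
have Qd k : Q k -> (k <= d)%N by move=> /asboolP[U <- _]; exact: rank_leq_row.
case: (ex_maxnP Q0 Qd) => k /asboolP[U rU UP] kmax.
exists U => v; split; last exact: UP.
move=> Pv; have : Q (\rank (U + v)%MS).
  apply/asboolP; exists (U + v)%MS => // w /sub_addsmxP[[a b] /= ->].
  apply: subspaceD => //; first by apply: UP; exact: submxMl.
  by rewrite [b]mx11_scalar mul_scalar_mx; exact: subspaceZ.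
move=> /kmax; rewrite -rU => le; apply: submx_trans (addsmxSr U v) _.
by have [_ <-] := mxrank_leqif_sup (addsmxSl U v); rewrite eqn_leq le mxrankS // addsmxSl.
Qed.

Section Burnside.
Variables (K : closedFieldType) (d : nat) (A : 'M[K]_d -> Prop).
Hypothesis sA : subspace A.
Hypothesis mulA : forall a b, A a -> A b -> A (a *m b).
Hypothesis transA : forall u v : 'rV[K]_d, u != 0 -> exists2 a, A a & u *m a = v.

(* Lomonosov and Rosenthal: if [x1 T] and [x2 T] are independent and [x1 T a = x2], then subtracting
   from [a T] an eigenvalue of its action on the row space of [T] lowers the rank of [T]. *)
Lemma exists_rank1 T : A T -> T != 0 -> exists2 T', A T' & \rank T' = 1%N.
Proof.
have [k] := ubnP (\rank T); elim: k T => // k IH T rT AT T0.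
have [r1|r1] := eqVneq (\rank T) 1%N; first by exists T.
have [i1 x1T] := exists_row_neq0 T0.
have [i2 x2T] : exists i, ~~ (row i T <= row i1 T)%MS.
  apply/existsP; apply: contraR r1; rewrite negb_exists => /forallP T1.
  have /mxrankS : (T <= row i1 T)%MS by apply/row_subP=> i; move: (T1 i); rewrite negbK.
  rewrite rank_rV x1T => le1; rewrite eqn_leq le1 lt0n mxrank_eq0 //.
have [a Aa aE] := transA (delta_mx 0 i2) x1T.
(* [C] is the matrix, in the basis [B] of the row space of T, of right multiplication by a T. *)
pose B := row_base T.
pose C := B *m a *m T *m pinvmx B.
have CB : C *m B = B *m a *m T by rewrite mulmxKpV // eq_row_base submxMl.
have [l lC] : exists l, root (char_poly C) l.
  apply/closed_rootP; rewrite size_char_poly.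
  by rewrite eqSS mxrank_eq0.
have rC : (\rank (C - l%:M)%R < \rank T)%N.
  rewrite ltn_neqAle rank_leq_row andbT -/(row_free _) -kermx_eq0.
  by rewrite -eigenvalue_root_char in lC.
pose T' := T *m a *m T - l *: T.
(* The factorization bounds the rank of [T'] by that of the singular matrix [C - l%:M]. *)
have T'E : T' = col_base T *m (C - l%:M) *m B.
  rewrite -[RHS]mulmxA mulmxBl CB mul_scalar_mx mulmxBr -scalemxAr.
  by rewrite (mulmxA _ _ T) (mulmxA _ _ a) mulmx_base.
apply: (IH T').
- rewrite ltnS in rT; apply: leq_trans rT; apply: leq_ltn_trans rC.
  by rewrite T'E; apply: leq_trans (mxrankM_maxl _ _) (mxrankM_maxr _ _).
- by rewrite /T' addrC -scaleNr; apply: sA.2 => //; apply: mulA => //; exact: mulA.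
apply: contra x2T => /eqP T'0; have : row i1 T' = 0 by rewrite T'0 row0.
rewrite /T' linearB linearZ /= !row_mul aE -rowE => /eqP; rewrite subr_eq0 => /eqP ->.
exact: scalemx_sub.
Qed.

(** Let c r be a rank one element of A. Sending r to any w by transitivity, A contains b c w for all
    b in A. If a nonzero row u annihilated all the columns b c, then, as u b takes every value, c
    would be 0. So the b c span all columns, and every matrix is a sum of products of a column and a
    row. *)
Theorem burnside a : A a.
Proof.
have [a0|na0] := eqVneq a 0; first by rewrite a0; exact: sA.1.
have [i _] := exists_row_neq0 na0.
have e0 : delta_mx 0 i != 0 :> 'rV[K]_d.
  by apply/eqP=> /matrixP/(_ 0 i)/eqP; rewrite !mxE !eqxx oner_eq0.
have [T0 AT0 T0E] := transA (delta_mx 0 i) e0.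
have [|T AT rT] := exists_rank1 AT0.
  by apply: contra_eqN T0E => /eqP ->; rewrite mulmx0 eq_sym.
have [|j rj] := @exists_row_neq0 _ _ _ T; first by rewrite -mxrank_eq0 rT.
pose r := row j T.
have Tr : (T <= r)%MS.
  by have [_ <-] := mxrank_leqif_sup (row_sub j T); rewrite rank_rV rj rT.
pose c : 'cV_d := T *m pinvmx r.
have TE : c *m r = T by rewrite mulmxKpV.
have c0 : c != 0 by apply: contra_eqN rT => /eqP c0; rewrite -TE c0 mul0mx mxrank0.
(* Columns are transposed so that [subspace_rowspace] can describe their span. *)
pose P (v : 'rV[K]_d) := forall w : 'rV[K]_d, A (v^T *m w).
have [|U UP] := @subspace_rowspace _ _ P.
  split=> [w|b u v Pu Pv w]; first by rewrite trmx0 mul0mx; exact: sA.1.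
  by rewrite linearP mulmxDl -scalemxAl; apply: sA.2.
have Pc b : A b -> P (b *m c)^T.
  move=> Ab w; have [b' Ab' <-] := transA w rj.
  by rewrite trmxK mulmxA -(mulmxA b) TE; apply: mulA => //; exact: mulA.
have fullU : row_full U.
  rewrite -cokermx_eq0 -trmx_eq0; apply/rowV0P=> u uU; apply/eqP; apply: contraNT c0 => u0.
  have uc b : A b -> u *m b *m c = 0.
    move=> /Pc/UP/submxP[y yE]; apply: trmx_inj; rewrite -mulmxA trmx_mul yE trmx0.
    move/submxP: uU => [x ->]; rewrite trmx_mul trmxK -mulmxA (mulmxA U).
    by rewrite mulmx_coker mul0mx mulmx0.
  apply/eqP/row_matrixP=> k; rewrite row0 rowE.
  by have [b Ab <-] := transA (delta_mx 0 k) u0; exact: uc.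
have -> : a = \sum_k col k a *m delta_mx 0 k.
  apply/matrixP=> x y; rewrite summxE (bigD1 y) //= big1 => [|k /negPf ky].
    by rewrite mxE big_ord1 !mxE !eqxx mulr1 addr0.
  by rewrite mxE big_ord1 !mxE [y == k]eq_sym ky andbF mulr0.
apply: subspace_sum => // k _; have /UP := submx_full (col k a)^T fullU.
by move=> /(_ (delta_mx 0 k)); rewrite trmxK.
Qed.

End Burnside.

(** * Isotypic decomposition *)

(* A map [phi : 'I_d -> M] stands for the linear map [lincomb phi] from K^d to M. *)
Section Intertwiners.
Variables (K : fieldType) (g1 : lieAlgType K) (M : lmodType K).
Variables (rho1 : lieRep g1 M) (d : nat) (g : g1 -> 'M[K]_d).

Definition intertwining : {pred {ffun 'I_d -> M}} :=
  [pred phi : {ffun 'I_d -> M} |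
    `[< forall a c, rho1 a (lincomb phi c) = lincomb phi (c *m g a) >]].

Lemma lincombP (k : K) (phi psi : {ffun 'I_d -> M}) c :
  lincomb (k *: phi + psi) c = k *: lincomb phi c + lincomb psi c.
Proof.
rewrite scaler_sumr -big_split; apply: eq_bigr => i _ /=.
by rewrite !ffunE scalerDr !scalerA mulrC.
Qed.

Fact intertwining_submod : submod_closed intertwining.
Proof.
split=> [|k phi psi /asboolP phiP /asboolP psiP]; apply/asboolP=> a c.
  have lin0 x : lincomb (0 : {ffun 'I_d -> M}) x = 0.
    by apply: big1 => i _; rewrite ffunE scaler0.
  by rewrite !lin0 linear0.
by rewrite !lincombP lie_act_linearr phiP psiP.
Qed.

HB.instance Definition _ :=
  GRing.isSubmodClosed.Build K {ffun 'I_d -> M} intertwining intertwining_submod.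

Record intertwiner := Intertwiner
  {intertwiner_fun :> {ffun 'I_d -> M}; intertwinerP : intertwiner_fun \in intertwining}.

HB.instance Definition _ := [isSub for intertwiner_fun].
HB.instance Definition _ := [Choice of intertwiner by <:].
HB.instance Definition _ := [SubChoice_isSubLmodule of intertwiner by <:].

End Intertwiners.

Section IntertwinerAction.
Variables (K : fieldType) (g1 g2 : lieAlgType K) (M : lmodType K).
Variables (rho1 : lieRep g1 M) (rho2 : lieRep g2 M) (d : nat) (g : g1 -> 'M[K]_d).
Hypothesis comm12 : forall a b v, rho1 a (rho2 b v) = rho2 b (rho1 a v).

Local Notation L := (intertwiner rho1 g).

Lemma lincomb_act b (phi : {ffun 'I_d -> M}) c :
  lincomb [ffun i => rho2 b (phi i)] c = rho2 b (lincomb phi c).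
Proof. by rewrite linear_sum; apply: eq_bigr => i _; rewrite ffunE linearZ. Qed.

Fact intertwiner_act_subproof b (phi : L) :
  [ffun i => rho2 b (phi i)] \in intertwining rho1 g.
Proof.
apply/asboolP=> a c; have /asboolP phiP := intertwinerP phi.
by rewrite !lincomb_act comm12 phiP.
Qed.

Definition intertwiner_act b (phi : L) : L := Intertwiner (intertwiner_act_subproof b phi).

Fact intertwiner_act_linearl phi : linear (intertwiner_act^~ phi).
Proof.
move=> k a b; apply: val_inj; apply/ffunP=> i; rewrite !ffunE.
exact: lie_act_linearl.
Qed.

Fact intertwiner_act_linearr b : linear (intertwiner_act b).
Proof.
move=> k phi psi; apply: val_inj; apply/ffunP=> i; rewrite !ffunE.
exact: lie_act_linearr.
Qed.

Fact intertwiner_act_lie a b phi : intertwiner_act (lie a b) phi =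
  intertwiner_act a (intertwiner_act b phi) - intertwiner_act b (intertwiner_act a phi).
Proof.
apply: val_inj; apply/ffunP=> i; rewrite !ffunE.
exact: lie_act_lie.
Qed.

Definition intertwiner_rep : lieRep g2 L :=
  LieRep intertwiner_act_linearl intertwiner_act_linearr intertwiner_act_lie.

End IntertwinerAction.

Section MatrixRep.
Variables (K : fieldType) (g1 : lieAlgType K) (M : lmodType K).
Variables (rho1 : lieRep g1 M) (d : nat) (b : 'I_d -> M) (g : g1 -> 'M[K]_d).
Hypothesis ib : independent b.
Hypothesis gE : forall a c, rho1 a (lincomb b c) = lincomb b (c *m g a).

(** The restriction of [rho1] to the span of [b], in coordinates; its axioms are pulled back along
    the injective map [lincomb b]. *)
Definition matrix_act a (c : 'rV[K]_d) := c *m g a.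

Fact matrix_act_linearl c : linear (matrix_act^~ c).
Proof.
move=> k x y; apply: (independent_inj ib); rewrite [RHS]linearP /= /matrix_act -!gE.
exact: lie_act_linearl.
Qed.

Fact matrix_act_linearr x : linear (matrix_act x).
Proof. by move=> k u v; rewrite /matrix_act mulmxDl -scalemxAl. Qed.

Fact matrix_act_lie x y c : matrix_act (lie x y) c =
  matrix_act x (matrix_act y c) - matrix_act y (matrix_act x c).
Proof.
apply: (independent_inj ib); rewrite linearB /matrix_act /= -!gE.
exact: lie_act_lie.
Qed.

Definition matrix_rep : lieRep g1 'rV[K]_d :=
  LieRep matrix_act_linearl matrix_act_linearr matrix_act_lie.

End MatrixRep.

Section MinimalSubmodule.
Variables (K : fieldType) (g1 : lieAlgType K) (M : lmodType K).
Variable rho1 : lieRep g1 M.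

(* Take a nonzero stable subspace of [N] of minimal dimension. *)
Lemma exists_irreducible_matrix_rep N : subspace N -> finite_dim_subspace N ->
  (forall a v, N v -> N (rho1 a v)) -> (exists2 v, N v & v <> 0) ->
  exists d (b : 'I_d -> M) (g : g1 -> 'M[K]_d)
    (ib : independent b) (gE : forall a c, rho1 a (lincomb b c) = lincomb b (c *m g a)),
  (forall i, N (b i)) /\ irreducible_rep (matrix_rep ib gE).
Proof.
move=> sN fN Nrho [v Nv nv].
pose Q d := `[< (0 < d)%N /\ exists b : 'I_d -> M, [/\ forall i, N (b i), independent b &
  forall a c, exists c', rho1 a (lincomb b c) = lincomb b c'] >].
have Qex : exists d, Q d.
  have [d [b [Nb ib sb]]] := finite_dim_basis fN; exists d; apply/asboolP; split.
    rewrite lt0n; apply/eqP=> d0; apply: nv; have [c ->] := sb _ Nv.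
    by apply: big1 => -[i id]; exfalso; rewrite d0 in id.
  exists b; split=> // a c.
  by apply: sb; apply: Nrho; exact: subspace_lincomb.
case: (ex_minnP Qex) => d /asboolP[d0 [b [Nb ib bst]]] dmin.
have /choice[g gE] a : exists A : 'M[K]_d, forall c, rho1 a (lincomb b c) = lincomb b (c *m A).
  apply: (@endo_matrix _ _ (fun v => exists c, v = lincomb b c) _ b (rho1 a)).
  - by move=> i; exists (delta_mx 0 i); rewrite lincomb_delta.
  - by [].
  - by move=> x [c ->]; exact: bst.
exists d, b, g, ib, gE; split=> //; split.
  exists (delta_mx 0 (Ordinal d0)) => /matrixP/(_ 0 (Ordinal d0))/eqP.
  by rewrite !mxE !eqxx oner_eq0.
move=> P [P0 PD Pst]; have [U UP] := subspace_rowspace (conj P0 PD).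
have [r0|r0] := posnP (\rank U).
  left=> x /UP; move/eqP: r0; rewrite mxrank_eq0 => /eqP ->.
  by rewrite submx0 => /eqP.
right=> x; apply/UP; apply: submx_full.
(* A basis of the row space of [U] gives a stable independent family of size [\rank U], so
   minimality of [d] forces full rank. *)
rewrite /row_full eqn_leq rank_leq_row dmin //; apply/asboolP; split=> //.
pose B := row_base U; pose b' i := lincomb b (row i B).
have bB c : lincomb b' c = lincomb b (c *m B) by rewrite lincomb_mul.
exists b'; split=> [i|c|a c].
- exact: subspace_lincomb.
- rewrite bB => /ib cB; have /row_free_inj := row_base_free U; apply.
  by rewrite cB mul0mx.
have /submxP[c' c'E] : (c *m B *m g a <= B)%MS.
  rewrite eq_row_base; apply/UP; apply: (Pst a); apply/UP.
  by rewrite -(eq_row_base U) submxMl.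
by exists c'; rewrite !bB gE c'E.
Qed.

End MinimalSubmodule.

Section Isotypic.
Variables (K : closedFieldType) (g1 g2 : lieAlgType K) (M : lmodType K).
Variables (rho1 : lieRep g1 M) (rho2 : lieRep g2 M).
Hypothesis comm12 : forall a b v, rho1 a (rho2 b v) = rho2 b (rho1 a v).
Hypothesis irr12 : forall N, subspace N -> (forall a v, N v -> N (rho1 a v)) ->
  (forall b v, N v -> N (rho2 b v)) -> (forall v, N v -> v = 0) \/ (forall v, N v).
Variables (d : nat) (b : 'I_d -> M) (g : g1 -> 'M[K]_d).
Hypothesis ib : independent b.
Hypothesis gE : forall a c, rho1 a (lincomb b c) = lincomb b (c *m g a).

Local Notation V := 'rV[K]_d.
Local Notation L := (intertwiner rho1 g).
Local Notation rhoV := (matrix_rep ib gE).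
Local Notation rhoL := (intertwiner_rep g comm12).
Hypothesis V_irr : irreducible_rep rhoV.

(** The evaluation v (x) phi -> phi(v), written on the basis of V. *)
Definition ev (t : tensor V L) : M := \sum_i lincomb (t i) (tbasis i).

Lemma intertwinerE (phi : L) a c : rho1 a (lincomb phi c) = lincomb phi (c *m g a).
Proof. by have /asboolP := intertwinerP phi. Qed.

Lemma lincomb_intertwiner_linear (c : V) : linear (fun phi : L => lincomb phi c).
Proof. by move=> k phi psi; rewrite -lincombP. Qed.

Lemma ev_linear : linear ev.
Proof.
move=> k t t'; rewrite /ev scaler_sumr -big_split; apply: eq_bigr => i _ /=.
by rewrite !ffunE lincomb_intertwiner_linear.
Qed.

Lemma ev_tens c (phi : L) : ev (tens c phi) = lincomb phi c.
Proof.
rewrite [in RHS](tbasis_sum c) linear_sum; apply: eq_bigr => i _.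
by rewrite ffunE linearZ (linear_mapZ (lincomb_intertwiner_linear _)).
Qed.

(** This family is the inclusion of V in M, which makes [L] nonzero. *)
Fact basis_intertwining : [ffun i => b i] \in intertwining rho1 g.
Proof.
apply/asboolP=> a c; have E x : lincomb [ffun i => b i] x = lincomb b x.
  by apply: eq_bigr => i _; rewrite ffunE.
by rewrite !E gE.
Qed.

Definition basis_intertwiner : L := Intertwiner basis_intertwining.

Lemma dim_gt0 : exists i : 'I_d, True.
Proof.
have [c nc] := V_irr.1; apply: contrapT => /forallNP nex; apply: nc.
by apply/rowP=> i; case: (nex i).
Qed.

Lemma basis_intertwiner_neq0 : basis_intertwiner <> 0.
Proof.
have [i _] := dim_gt0; move=> /(congr1 val)/ffunP/(_ i); rewrite !ffunE => bi0.
have /ib/matrixP/(_ 0 i)/eqP : lincomb b (delta_mx 0 i) = 0 by rewrite lincomb_delta.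
by rewrite !mxE !eqxx oner_eq0.
Qed.

(* By Burnside's theorem, a relation [\sum_i phi_i(v_i) = 0] between intertwiners is preserved by every
   endomorphism of V acting on the [v_i], in particular by those of rank one. *)
Lemma intertwiner_relation m (t : 'I_m -> L) (v : 'I_m -> V) (a : 'M[K]_d) :
  \sum_i lincomb (t i) (v i) = 0 -> \sum_i lincomb (t i) (v i *m a) = 0.
Proof.
pose A x := forall v : 'I_m -> V,
  \sum_i lincomb (t i) (v i) = 0 -> \sum_i lincomb (t i) (v i *m x) = 0.
suff Aa : A a by exact: Aa.
have sA : subspace A.
  split=> [w _|k x y Ax Ay w w0]; first by apply: big1 => i _; rewrite mulmx0 linear0.
  under eq_bigr do rewrite mulmxDr -scalemxAr linearP.
  by rewrite big_split -scaler_sumr /= Ax // Ay // scaler0 addr0.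
have mulA x y : A x -> A y -> A (x *m y).
  move=> Ax Ay w w0; under eq_bigr do rewrite mulmxA.
  exact: (Ay (fun i => w i *m x) (Ax w w0)).
apply: (burnside sA mulA) => u w u0.
(* The orbit of [u] is a submodule because [A] contains every [g c], and it contains [u] because [A]
   contains 1; irreducibility of V then gives transitivity. *)
pose N w := exists2 x, A x & w = u *m x.
have [|N0|/(_ w)[x Ax ->]] := V_irr.2 N; last by exists x.
  split=> [|k p q [x Ax ->] [y Ay ->]|c _ [x Ax ->]].
  - by exists 0; [exact: sA.1|rewrite mulmx0].
  - by exists (k *: x + y); [exact: sA.2|rewrite mulmxDr -scalemxAr].
  exists (x *m g c); last by rewrite mulmxA.
  apply: mulA => // p p0; under eq_bigr do rewrite -intertwinerE.
  by rewrite -linear_sum p0 linear0.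
case/eqP: u0; apply: N0; exists 1%:M; last by rewrite mulmx1.
by move=> p; under [X in _ -> X = _]eq_bigr do rewrite mulmx1.
Qed.

(** Applying to the relation the rank one endomorphism that sends the i-th basis vector to e_j and
    the others to 0 leaves phi_i(e_j) = 0. *)
Lemma ev_eq0 t : ev t = 0 -> t = 0.
Proof.
move=> t0; apply/ffunP=> i; rewrite ffunE; apply: val_inj; apply/ffunP=> j; rewrite ffunE.
pose f (c : V) : V := coord (vbasis {:V}) i c *: delta_mx 0 j.
have lf : linear f by move=> k x y; rewrite /f linearP scalerDl scalerA.
have [A AE] : exists A, forall c, c *m A = f c.
  exists (\matrix_k f (delta_mx 0 k)) => c.
  rewrite mulmx_sum_row [c in RHS]row_sum_delta (linear_map_sum lf).
  by apply: eq_bigr => k _; rewrite rowK (linear_mapZ lf).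
have := intertwiner_relation A t0.
rewrite (bigD1 i) //= big1 ?addr0 => [|k /negPf ki]; rewrite AE /f.
  by rewrite coord_free ?(basis_free (vbasisP _)) // eqxx scale1r lincomb_delta.
by rewrite coord_free ?(basis_free (vbasisP _)) // ki scale0r linear0.
Qed.

Lemma ev_act1 a t : rho1 a (ev t) = ev (\sum_i tens (tbasis i *m g a) (t i)).
Proof.
rewrite [in LHS]/ev linear_sum (linear_map_sum ev_linear); apply: eq_bigr => i _ /=.
by rewrite ev_tens intertwinerE.
Qed.

Lemma ev_act2 x t : rho2 x (ev t) = ev [ffun i => rhoL x (t i)].
Proof.
rewrite linear_sum; apply: eq_bigr => i _.
by rewrite ffunE /= lincomb_act.
Qed.

(** The image of V (x) N is stable under both actions and nonzero, hence all of M. With N = L this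
    is surjectivity of [ev]; for general N it yields irreducibility of L. *)
Lemma ev_submodule (N : L -> Prop) : submodule rhoL N -> (exists2 phi, N phi & phi <> 0) ->
  forall v, exists2 t, v = ev t & forall i, N (t i).
Proof.
move=> [N0 ND Nst] [phi Nphi nphi].
have sN : subspace N by split.
have Ntens c psi : N psi -> forall i, N (tens c psi i).
  by move=> Npsi i; rewrite ffunE; exact: subspaceZ.
pose P v := exists2 t, v = ev t & forall i, N (t i).
have [|a _ [t -> Nt]|x _ [t -> Nt]|P0|] := irr12 (N := P); last by [].
- split=> [|k _ _ [t -> Nt] [t' -> Nt']].
    by exists 0; [rewrite (linear_map0 ev_linear)|move=> i; rewrite ffunE].
  exists (k *: t + t'); first by rewrite ev_linear.
  by move=> i; rewrite !ffunE; exact: sN.2.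
- rewrite ev_act1; eexists; first by [].
  by move=> j; rewrite sum_ffunE; apply: subspace_sum => // i _; exact: Ntens.
- rewrite ev_act2; eexists; first by [].
  by move=> i; rewrite ffunE; exact: Nst.
case: nphi; apply: val_inj; apply/ffunP=> i; rewrite ffunE -[LHS]lincomb_delta -ev_tens.
by apply: P0; exists (tens (delta_mx 0 i) phi) => // j; exact: Ntens.
Qed.

Lemma ev_surjective v : exists t, v = ev t.
Proof.
have [||t] := @ev_submodule (fun=> True) _ _ v; last by exists t.
  by split.
by exists basis_intertwiner; last exact: basis_intertwiner_neq0.
Qed.

Lemma rhoL_irreducible : irreducible_rep rhoL.
Proof.
split=> [|N sub]; first by exists basis_intertwiner; exact: basis_intertwiner_neq0.
have [allN|/existsNP[phi /not_implyP[Nphi nphi]]] := pselect (forall phi, N phi -> phi = 0).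
  by left.
(* By injectivity of [ev], the tensor c (x) psi has its coordinates in [N]; dividing by a nonzero
   coordinate of c puts psi in [N]. *)
right=> psi; have [i _] := dim_gt0; pose c : V := delta_mx 0 i.
have [|t tE Nt] := ev_submodule sub _ (ev (tens c psi)); first by exists phi.
have sN := submodule_subspace sub.
have tensE : tens c psi = t.
  apply/eqP; rewrite -subr_eq0; apply/eqP/ev_eq0.
  by rewrite (linear_mapD ev_linear) (linear_mapN ev_linear) tE subrr.
have [j cj] : exists j, coord (vbasis {:V}) j c != 0.
  apply: contrapT => /forallNP c0; have : c = 0.
    rewrite [c]tbasis_sum; apply: big1 => j _.
    by have /negP/negPn/eqP -> := c0 j; rewrite scale0r.
  by move=> /matrixP/(_ 0 i)/eqP; rewrite !mxE !eqxx oner_eq0.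
have := Nt j; rewrite -tensE ffunE => /(subspaceZ sN (coord (vbasis {:V}) j c)^-1).
by rewrite scalerA mulVf // scale1r.
Qed.

Lemma ev_inverse : exists2 phi : M -> tensor V L, cancel phi ev & cancel ev phi.
Proof.
have [phi phiE] := choice ev_surjective.
exists phi => [v|t]; first by rewrite -phiE.
apply/eqP; rewrite -subr_eq0; apply/eqP/ev_eq0.
by rewrite (linear_mapD ev_linear) (linear_mapN ev_linear) -phiE subrr.
Qed.

End Isotypic.

(** * Restriction to so_n and sl_2 *)

Lemma lin_span_eigenvectors (K : fieldType) (M : lmodType K) (H : {linear M -> M}) v :
  lin_span (fun u => exists a, H u = a *: u) v ->
  exists (s : seq K) (w : K -> M),
    (forall a, H (w a) = a *: w a) /\ v = \sum_(a <- s) w a.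
Proof.
move=> Gv; suff [s [w [_ wH ->]]] : exists (s : seq K) (w : K -> M),
    [/\ uniq s, forall a, H (w a) = a *: w a & v = \sum_(a <- s) w a] by exists s, w.
elim: Gv => [|c u x [a Hu] _ [s [w [us wH ->]]]].
  by exists [::], (fun=> 0); split=> [||] *; rewrite ?big_nil // linear0 scaler0.
(* The value [w a] may be nonzero even when [a] is not in [s]; it must then be discarded, since it
   does not occur in the sum. *)
pose w' y := if y == a then c *: u + (if a \in s then w a else 0) else w y.
have w'H y : H (w' y) = y *: w' y.
  rewrite /w'; case: eqP => [->|//]; rewrite linearP Hu scalerDr !scalerA mulrC.
  by case: ifP => _; rewrite ?wH // linear0 scaler0.
have w'E r : a \notin r -> \sum_(y <- r) w' y = \sum_(y <- r) w y.
  move=> ar; rewrite !big_seq; apply: eq_bigr => y yr.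
  by rewrite /w' ifN //; apply: contraNneq ar => <-.
case: (boolP (a \in s)) => as_; last first.
  exists (a :: s), w'; split=> //=; first by rewrite as_.
  by rewrite big_cons w'E // /w' eqxx (negPf as_) addr0.
exists s, w'; split=> //; rewrite !(big_rem a as_) /= w'E.
  by rewrite /w' eqxx as_ addrA.
by rewrite mem_rem_uniq // inE eqxx.
Qed.

(** The span of the weight vectors is a submodule, as e and f shift weights by 2 and -2, so a single
    nonzero weight vector is enough. *)
Lemma sl2_irreducible_weight_span (K : fieldType) (L : lmodType K)
    (rho : lieRep (sl2 K) L) a v :
  irreducible_rep rho -> v <> 0 -> weight_space rho (sl2_h K) a v ->
  forall u, exists (s : seq K) (w : K -> L),
    (forall a, weight_space rho (sl2_h K) a (w a)) /\ u = \sum_(a <- s) w a.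
Proof.
move=> irr nv Hv u; pose G x := exists a, rho (sl2_h K) x = a *: x.
apply: (lin_span_eigenvectors (H := rho (sl2_h K))).
have [|N0|] := irr.2 (lin_span G); last by apply.
  have sG := lin_span_subspace G; split=> [||p x Gx]; [exact: sG.1|exact: sG.2|].
  rewrite [p]sl2_decomp !lie_actDl !lie_actZl.
  do !apply: subspaceD => //; apply: subspaceZ => //; apply: lin_span_stable Gx => y [c Hy] /=.
  - by rewrite Hy; apply: subspaceZ => //; apply: mem_lin_span; exists c.
  - by apply: mem_lin_span; exists (c + 2); rewrite lie_actC Hy linearZ sl2_he lie_actZl scalerDl.
  by apply: mem_lin_span; exists (c - 2); rewrite lie_actC Hy linearZ sl2_hf lie_actNl lie_actZl scalerBl.
by case: nv; apply: N0; apply: mem_lin_span; exists a.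
Qed.

Lemma submodule_levi_res (K : fieldType) n (M : lmodType K) (rho : lieRep (schrodinger K n) M) N :
  (forall u v, rho (heis_in u) v = 0) -> submodule (levi_res rho) N -> submodule rho N.
Proof.
move=> h0 [N0 ND Nst]; split=> // p v Nv.
rewrite [p]schrodinger_decomp lie_actDl h0 addr0; case: p => [[A s] u].
exact: (Nst (s, A)).
Qed.

Section Factors.
Variables (K : fieldType) (n : nat) (M : lmodType K) (rho : lieRep (schrodinger K n) M).

Definition so_res_act (s : so K n) : M -> M := rho (levi_in (0, s)).

Fact so_res_linearl v : linear (so_res_act^~ v).
Proof.
move=> a s t; rewrite /so_res_act -(lie_act_linearl rho v a).
by congr (rho _ v); apply: schrodinger_eq; rewrite /= ?scaler0 ?addr0.
Qed.

Fact so_res_lie s t v :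
  so_res_act (lie s t) v = so_res_act s (so_res_act t v) - so_res_act t (so_res_act s v).
Proof.
by rewrite /so_res_act -lie_act_lie lie_levi /lie /= /prod_lie /= liexx.
Qed.

Definition so_res : lieRep (so K n) M :=
  LieRep so_res_linearl (fun s => lie_act_linearr rho _) so_res_lie.

Definition sl2_res_act (A : sl2 K) : M -> M := rho (levi_in (A, 0)).

Fact sl2_res_linearl v : linear (sl2_res_act^~ v).
Proof.
move=> a A B; rewrite /sl2_res_act -(lie_act_linearl rho v a).
by congr (rho _ v); apply: schrodinger_eq; rewrite /= ?scaler0 ?addr0.
Qed.

Fact sl2_res_lie A B v :
  sl2_res_act (lie A B) v = sl2_res_act A (sl2_res_act B v) - sl2_res_act B (sl2_res_act A v).
Proof.
by rewrite /sl2_res_act -lie_act_lie lie_sl2.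
Qed.

Definition sl2_res : lieRep (sl2 K) M :=
  LieRep sl2_res_linearl (fun A => lie_act_linearr rho _) sl2_res_lie.

Lemma so_sl2_commute s A v : so_res s (sl2_res A v) = sl2_res A (so_res s v).
Proof.
by apply/esym; rewrite /= /sl2_res_act /so_res_act lie_actC lie_sl2_so_in lie_act0l addr0.
Qed.

End Factors.

Lemma tensor_decomposition (K : numClosedFieldType) (n : nat)
    (M : lmodType K) (rho : lieRep (schrodinger K n) M) :
  irreducible_rep rho -> harish_chandra_rep rho (sch_h K n) ->
  (forall u v, rho (heis_in u) v = 0) ->
  exists (V : vectType K) (L : lmodType K)
         (rhoV : lieRep (so K n) V) (rhoL : lieRep (sl2 K) L),
    [/\ irreducible_rep rhoV, irreducible_rep rhoL,
        weight_rep rhoL (sl2_h K) & rep_iso rho (tensor_rep rhoV rhoL)].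
Proof.
move=> M_irr M_hc heis0.
have [a [v [nv Hv]]] := nonzero_weight_vector M_irr M_hc.
(* V is found inside one weight space, which is finite dimensional, nonzero, and stable because so_n
   commutes with h. *)
have [||d [b [g [ib [gE [Wb V_irr]]]]]] := exists_irreducible_matrix_rep
    (rho1 := so_res rho) (weight_space_subspace rho a) (M_hc.2 a).
- move=> s u Hu; rewrite /weight_space /= /so_res_act lie_actC lie_sl2_so_in lie_act0l addr0.
  by rewrite Hu linearZ.
- by exists v.
have comm := so_sl2_commute rho.
have irr N : subspace N -> (forall s v, N v -> N (so_res rho s v)) ->
    (forall A v, N v -> N (sl2_res rho A v)) -> (forall v, N v -> v = 0) \/ (forall v, N v).
  move=> sN N1 N2; apply: M_irr.2; split=> [||p x Nx]; [exact: sN.1|exact: sN.2|].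
  rewrite [p]schrodinger_decomp levi_decomp !lie_actDl heis0 addr0.
  by apply: subspaceD => //; [exact: N2|exact: N1].
pose rhoL := intertwiner_rep g comm.
have L_irr : irreducible_rep rhoL by exact: (rhoL_irreducible comm irr V_irr).
exists 'rV[K]_d, (intertwiner (so_res rho) g), (matrix_rep ib gE), rhoL; split=> //.
  split.
    (* The inclusion of V has weight [a] in L, since V lies in the weight space of [a] in M. *)
    apply: (@sl2_irreducible_weight_span _ _ _ a (basis_intertwiner gE)) => //.
      exact: basis_intertwiner_neq0 V_irr.
    by apply: val_inj; apply/ffunP=> i; rewrite !ffunE; exact: Wb.
  (* Independence is inherited from M by evaluating the intertwiners at each basis vector of V. *)
  move=> s w us wH w0 c cs; apply: val_inj; apply/ffunP=> i; rewrite [RHS]ffunE.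
  apply: (M_hc.1.2 s (fun c => (w c : {ffun _ -> _}) i)) cs => // [c'|].
    by have /(congr1 val)/ffunP/(_ i) := wH c'; rewrite !ffunE.
  have lin : linear (fun x : intertwiner (so_res rho) g => (x : {ffun _ -> _}) i).
    by move=> k x y; rewrite !ffunE.
  by rewrite -(linear_map_sum lin) w0 ffunE.
have [phi phiK evK] := ev_inverse comm irr V_irr.
have lev := @ev_linear _ _ _ (so_res rho) d g.
exists phi; split=> [k x y||p x].
- by apply: (can_inj evK); rewrite phiK lev !phiK.
- by exists (@ev _ _ _ (so_res rho) d g).
(* It is enough that the inverse map [ev] is equivariant, and this is checked on pure tensors. *)
apply: (can_inj evK); rewrite phiK.
rewrite -{1}[x]phiK; move: (phi x) => t.
apply: (tensor_ext (f := fun t => rho p (ev t)) (g := fun t => ev (tensor_act (matrix_rep ib gE) rhoL p t))).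
- by move=> k x' y; rewrite lev linearP.
- by move=> k x' y; rewrite tensor_act_linearr lev.
move=> c psi; rewrite tensor_actE (linear_mapD lev) !ev_tens.
rewrite [p in LHS]schrodinger_decomp levi_decomp !lie_actDl heis0 addr0 addrC.
by congr (_ + _); [exact: (intertwinerE psi p.1.2 c)|exact: (esym (lincomb_act (sl2_res rho) p.1.1 psi c))].
Qed.

Theorem theorem8 (R : realType) (n : nat) (n_gt0 : (0 < n)%N)
    (M : lmodType R[i]) (rho : lieRep (schrodinger R[i] n) M)
    (M_irr : irreducible_rep rho)
    (M_hc : harish_chandra_rep rho (sch_h R[i] n))
    (z_act0 : forall v : M, rho (sch_z R[i] n) v = 0) :
  (forall (u : heis R[i] n) (v : M), rho (heis_in u) v = 0) /\
  irreducible_rep (levi_res rho) /\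
  exists (V : vectType R[i]) (L : lmodType R[i])
         (rhoV : lieRep (so R[i] n) V) (rhoL : lieRep (sl2 R[i]) L),
    [/\ irreducible_rep rhoV, irreducible_rep rhoL,
        weight_rep rhoL (sl2_h R[i]) &
        rep_iso rho (tensor_rep rhoV rhoL)].
Proof.
have heis0 := heis_act0 M_irr M_hc z_act0.
split=> //; split; last exact: tensor_decomposition.
by split=> [|N /(submodule_levi_res heis0)]; [exact: M_irr.1|exact: M_irr.2].
Qed.
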